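(* Let $f\in\mathbb{C}(z)$ be a rational map of degree $d\geq 1$ and let $F$ be any homogeneous lift of $f$. Then $$R(F)=d\,\log\left(\frac{\mathrm{pcap}(S^3)}{\mathrm{pcap}(F^{-1}(S^3))}\right).$$
   Context: A homogeneous lift of $f$ is $F=(F_0,F_1):\mathbb{C}^2\to\mathbb{C}^2$ with $F_0,F_1\in\mathbb{C}[X,Y]$ coprime homogeneous of degree $d$ and $f(z)=F_0(z,1)/F_1(z,1)$. $S^3$ is the unit sphere of $\mathbb{C}^2$ for the Euclidean norm $\|\cdot\|$, $\sigma$ its rotation-invariant probability measure, and $R(F)=\int_{S^3}\log\|F(v)\|\,d\sigma(v)$. Projective capacity (Alexander): for compact $E\subseteq\mathbb{C}^2$ and a function $h$ on $E$ let $\|h\|_E=\sup_{z\in E}|h(z)|$, and for $k\ge1$ let $$m_k(E)=\inf\left\{\|Q\|_E : Q\in\mathbb{C}[X,Y]\text{ homogeneous of degree }k,\ \int_{S^3}\log|Q|\,d\sigma=k\int_{S^3}\log|z_1|\,d\sigma\right\},$$ where $z_1$ is the first coordinate function on $\mathbb{C}^2$. Then $\mathrm{pcap}(E)=\lim_{k\to\infty}m_k(E)^{1/k}$ (the limit always exists). *)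

(* Defs.v *)
From HB Require Import structures.
From mathcomp Require Import all_boot all_order all_algebra fraction.
(* The notations of mpoly clash with those of mathcomp-analysis. *)
From mathcomp Require Import -(notations) mpoly.
From mathcomp Require Import complex.
From mathcomp Require Import all_classical all_reals all_analysis.

Set Implicit Arguments.
Unset Strict Implicit.
Unset Printing Implicit Defensive.

Import Order.TTheory GRing.Theory Num.Theory.
Import numFieldNormedType.Exports.

Local Open Scope classical_set_scope.
Local Open Scope ring_scope.
Local Open Scope complex_scope.

Notation C2 R := (R[i] * R[i])%type.
Notation polyXY R := (mpoly 2 R[i]).

Section Lifts.
Variable R : realType.
Implicit Types (Q : polyXY R) (F : polyXY R * polyXY R) (z : C2 R).

Definition homogeneous (k : nat) Q : Prop := Q \is ishomog1 k mdeg.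

Definition coords2 (T : Type) (x y : T) (i : 'I_2) : T :=
  if i == ord0 then x else y.

Definition evalXY Q z : R[i] := meval (coords2 z.1 z.2) Q.

Definition eval_lift F z : C2 R := (evalXY F.1 z, evalXY F.2 z).

(* Q(z, 1), as a polynomial in z *)
Definition dehomogenize Q : {poly R[i]} := mmap polyC (coords2 'X 1) Q.

(* The units of C[X,Y] are the nonzero constants. *)
Definition coprimeXY (P Q : polyXY R) : Prop :=
  forall G P1 Q1 : polyXY R, P = G * P1 -> Q = G * Q1 -> G \is a GRing.unit.

Definition has_degree (f : {fraction {poly R[i]}}) (d : nat) : Prop :=
  exists p q : {poly R[i]},
    [/\ q != 0, coprimep p q, f = tofrac p / tofrac q
      & maxn (size p).-1 (size q).-1 = d].

Definition homogeneous_lift (f : {fraction {poly R[i]}}) (d : nat) F : Prop :=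
  [/\ homogeneous d F.1, homogeneous d F.2, coprimeXY F.1 F.2
    & f = tofrac (dehomogenize F.1) / tofrac (dehomogenize F.2)].

End Lifts.

Section Capacity.
Variable R : realType.
Implicit Types (Q : polyXY R) (F : polyXY R * polyXY R) (z : C2 R).
Implicit Types (E : set (C2 R)).

(* Real-valued modulus on R[i]; the generic norm of R[i] is R[i]-valued. *)
Definition modulus (c : R[i]) : R := Normc.normc c.

Definition norm2 z : R := Num.sqrt (modulus z.1 ^+ 2 + modulus z.2 ^+ 2).

Definition S3 : set (C2 R) := [set z | norm2 z = 1].

(* Measures on C^2 live on R^4, whose Borel sigma-algebra the library provides
   on 4-tuples; the real coordinates are Re z1, Im z1, Re z2, Im z2. *)
Definition toC2 (x : 4.-tuple R) : C2 R :=
  ([tnth x 0] +i* [tnth x 1], [tnth x 2] +i* [tnth x 3]).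

Definition linear_act (A : 'M[R]_4) (x : 4.-tuple R) : 4.-tuple R :=
  [tuple \sum_(j < 4) A i j * tnth x j | i < 4].

(* sigma is carried by S^3 and invariant under SO(4); these conditions
   determine the probability measure sigma uniquely. *)
Definition rotation_invariant_on_S3 (sigma : probability (4.-tuple R) R) :
    Prop :=
  sigma (toC2 @^-1` S3) = 1%E /\
  forall A : 'M[R]_4, A *m A^T = 1%:M -> \det A = 1 ->
    forall B : set (4.-tuple R), measurable B ->
      sigma (linear_act A @^-1` B) = sigma B.

Variable sigma : probability (4.-tuple R) R.

(* The integral over S^3 of log h, with log 0 = -oo. *)
Definition int_log (h : C2 R -> R) : \bar R :=
  (\int[sigma]_(x in toC2 @^-1` S3) lne (h (toC2 x))%:E)%E.

Definition log_norm_integral F : \bar R :=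
  int_log (fun z => norm2 (eval_lift F z)).

(* On nonempty compact E, where it is used, this real sup is not a default
   value; the same holds for the inf and the limit below. *)
Definition sup_norm E (h : C2 R -> R[i]) : R :=
  sup [set modulus (h z) | z in E].

Definition normalized (k : nat) Q : Prop :=
  homogeneous k Q /\
  int_log (fun z => modulus (evalXY Q z)) =
    (k%:R%:E * int_log (fun z => modulus z.1))%E.

Definition cap_min E (k : nat) : R :=
  inf [set sup_norm E (evalXY Q) | Q in [set Q | normalized k Q]].

Definition pcap E : R := limn (fun k : nat => cap_min E k `^ k%:R^-1).

End Capacity.
Arguments S3 {R}.

(* Main.v *)
(* Write J for minus the integral of log |z1| over the sphere, and let F be
   homogeneous of degree d without nontrivial zeros, E = F^-1(S^3) and
   u = log ||F|| / d, so that E = {u = 0}. Then pcap(E) = exp (- J - \int u), and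
   the theorem follows by comparing F with the identity.
   Lower bound: log |Q| <= log ||Q||_E + k u by homogeneity, for Q of degree k;
   integrate over the sphere.
   Upper bound: take for Q a product of linear forms a_i . F, with the a_i nearly
   equidistributed on the sphere. By rotation invariance the mean over a of
   log |a . v| is log ||v|| - J; so on E, where ||F|| = 1, log |Q| is at most about
   - J per factor, while by Fubini the integral of log |a . F| over the sphere has
   mean d \int u - J over a. *)
Require Import Defs.
From mathcomp Require Import all_boot all_order all_algebra fraction.
From mathcomp Require Import -(notations) mpoly.
From mathcomp Require Import complex.
From mathcomp Require Import all_classical all_reals all_analysis.
From mathcomp Require Import measurable_realfun ring lra zify.

Set Implicit Arguments.
Unset Strict Implicit.
Unset Printing Implicit Defensive.

Import Order.TTheory GRing.Theory Num.Theory.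
Import numFieldNormedType.Exports.

Local Open Scope classical_set_scope.
Local Open Scope ring_scope.

Local Notation Re := complex.Re.
Local Notation Im := complex.Im.
Local Notation X2 := (lift ord0 ord0 : 'I_2).
(* Convertible to the indices in toC2, unlike the canonical 0, 1, 2, 3 of I_4. *)
Local Notation i4_0 := (@Ordinal 4 0 (erefl true)).
Local Notation i4_1 := (@Ordinal 4 1 (erefl true)).
Local Notation i4_2 := (@Ordinal 4 2 (erefl true)).
Local Notation i4_3 := (@Ordinal 4 3 (erefl true)).

#[local] Arguments modulus : simpl never.
#[local] Arguments norm2 : simpl never.

(** * Norms and evaluation on C^2 *)

Section Norms.
Variable R : realType.
Implicit Types (a b c : R[i]) (z w : C2 R) (Q : polyXY R) (k : nat).

(** The obstacle is that log |a . v| is unbounded below, so no finite set of points samples it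
    uniformly. But the points are used only for one-sided estimates. For the bound on E, log t is
    replaced by the larger log (t + d), whose slope is at most 1/d, so that one fine partition
    serves all unit vectors at once; the loss in the mean is controlled by a quantitative
    integrability estimate. For the integral of log |a . F| nothing uniform is needed: each cell of
    positive measure has a point no worse than the mean, up to epsilon. Integrability of log |z1|
    comes from rotation invariance alone, without a density. J is never computed, as it cancels in
    the end. Arguments of logarithms are divided by an upper bound M and signs are reversed, which
    makes the integrands nonnegative, so that Tonelli applies. The pairing [dot] is bilinear,
    without conjugation, so that a . F is a polynomial. *)

Definition dot w z : R[i] := w.1 * z.1 + w.2 * z.2.

Lemma modulus_ge0 c : 0 <= modulus c.
Proof. by case: c => x y; exact: sqrtr_ge0. Qed.

Lemma modulusM a b : modulus (a * b) = modulus a * modulus b.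
Proof. exact: Normc.normcM. Qed.

Lemma modulusD a b : modulus (a + b) <= modulus a + modulus b.
Proof. exact: le_normcD. Qed.

Lemma modulusN c : modulus (- c) = modulus c.
Proof. by case: c => x y; rewrite /modulus /= !sqrrN. Qed.

Lemma modulus0 : modulus (0 : R[i]) = 0.
Proof. exact: Normc.normc0. Qed.

Lemma modulus1 : modulus (1 : R[i]) = 1.
Proof. exact: Normc.normc1. Qed.

Lemma modulusX c k : modulus (c ^+ k) = modulus c ^+ k.
Proof.
by elim: k => [|k IH]; rewrite ?expr0 ?modulus1// !exprS modulusM IH.
Qed.

Lemma modulus_prod (I : finType) (f : I -> R[i]) :
  modulus (\prod_i f i) = \prod_i modulus (f i).
Proof. by apply: (big_morph _ modulusM modulus1). Qed.

Lemma modulus_sum (I : Type) (s : seq I) (f : I -> R[i]) :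
  modulus (\sum_(i <- s) f i) <= \sum_(i <- s) modulus (f i).
Proof.
elim: s => [|x s IH]; first by rewrite !big_nil modulus0.
by rewrite !big_cons (le_trans (modulusD _ _))// lerD2l.
Qed.

Lemma sqr_modulus c : modulus c ^+ 2 = Re c ^+ 2 + Im c ^+ 2.
Proof.
by case: c => x y; rewrite /modulus /= sqr_sqrtr// addr_ge0// sqr_ge0.
Qed.

Lemma modulus_real (t : R) : modulus t%:C%C = `|t|.
Proof. by rewrite /modulus /= expr0n/= addr0 sqrtr_sqr. Qed.

Lemma modulus_le c : modulus c <= `|Re c| + `|Im c|.
Proof.
rewrite -(@ler_pXn2r _ 2)// ?nnegrE ?modulus_ge0 ?addr_ge0//.
rewrite sqr_modulus -(real_normK (num_real (Re c))).
rewrite -(real_normK (num_real (Im c))).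
by move: (normr_ge0 (Re c)) (normr_ge0 (Im c)); nra.
Qed.

Lemma norm2_ge0 z : 0 <= norm2 z.
Proof. exact: sqrtr_ge0. Qed.

Lemma sqr_norm2 z : norm2 z ^+ 2 = modulus z.1 ^+ 2 + modulus z.2 ^+ 2.
Proof. by rewrite sqr_sqrtr// addr_ge0// sqr_ge0. Qed.

Lemma le_norm2 z (t : R) : 0 <= t ->
  modulus z.1 ^+ 2 + modulus z.2 ^+ 2 <= t ^+ 2 -> norm2 z <= t.
Proof.
move=> t0; rewrite -sqr_norm2 ler_pXn2r// nnegrE//; exact: norm2_ge0.
Qed.

Lemma modulus1_le_norm2 z : modulus z.1 <= norm2 z.
Proof.
rewrite -(@ler_pXn2r _ 2)// ?nnegrE ?modulus_ge0 ?norm2_ge0// sqr_norm2.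
by rewrite lerDl sqr_ge0.
Qed.

Lemma modulus2_le_norm2 z : modulus z.2 <= norm2 z.
Proof.
rewrite -(@ler_pXn2r _ 2)// ?nnegrE ?modulus_ge0 ?norm2_ge0// sqr_norm2.
by rewrite lerDr sqr_ge0.
Qed.

Lemma norm2_scale c z : norm2 (c * z.1, c * z.2) = modulus c * norm2 z.
Proof.
rewrite {1}/norm2 /= !modulusM !exprMn -mulrDr sqrtrM ?sqr_ge0//.
by rewrite sqrtr_sqr ger0_norm// modulus_ge0.
Qed.

Lemma norm2_eq0 z : norm2 z = 0 -> z = (0, 0).
Proof.
case: z => a b h.
have /eqP : modulus a ^+ 2 + modulus b ^+ 2 = 0.
  by have := sqr_norm2 (a, b); rewrite h expr0n.
rewrite paddr_eq0 ?sqr_ge0// !expf_eq0 /= => /andP[/eqP a0 /eqP b0].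
by rewrite (Normc.eq0_normc a0) (Normc.eq0_normc b0).
Qed.

(** Cauchy-Schwarz, from Lagrange's identity applied to the moduli. *)
Lemma modulus_dot w z : modulus (dot w z) <= norm2 w * norm2 z.
Proof.
apply: (@le_trans _ _ (modulus w.1 * modulus z.1 + modulus w.2 * modulus z.2)).
  by rewrite (le_trans (modulusD _ _))// !modulusM.
have m := @modulus_ge0; have n := @norm2_ge0.
rewrite -(@ler_pXn2r _ 2)// ?nnegrE ?addr_ge0 ?mulr_ge0// exprMn !sqr_norm2.
rewrite -subr_ge0; set u := modulus w.1; set v := modulus z.1.
set p := modulus w.2; set q := modulus z.2.
suff -> : (u ^+ 2 + p ^+ 2) * (v ^+ 2 + q ^+ 2) - (u * v + p * q) ^+ 2
  = (u * q - p * v) ^+ 2 by exact: sqr_ge0.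
by ring.
Qed.

Lemma evalXY_sum Q z :
  evalXY Q z =
  \sum_(m <- msupp Q) mcoeff m Q * (z.1 ^+ m ord0 * z.2 ^+ m X2).
Proof.
rewrite /evalXY mevalE; apply: eq_bigr => m _; congr (_ * _).
by rewrite big_ord_recl big_ord1.
Qed.

Lemma homogeneous_exponents k Q m : homogeneous k Q -> m \in msupp Q ->
  (m ord0 + m X2)%N = k.
Proof.
by move=> /dhomogP h /h <-; rewrite -[RHS]/(mdeg m) mdegE big_ord_recl big_ord1.
Qed.

Lemma evalXY_scale k Q c z : homogeneous k Q ->
  evalXY Q (c * z.1, c * z.2) = c ^+ k * evalXY Q z.
Proof.
move=> h; rewrite !evalXY_sum mulr_sumr big_seq [RHS]big_seq.
apply: eq_bigr => m /(homogeneous_exponents h) <-.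
by rewrite /= !exprMn exprD; ring.
Qed.

Lemma evalXY_bounded Q (r : R) :
  exists B, forall z, norm2 z <= r -> modulus (evalXY Q z) <= B.
Proof.
exists (\sum_(m <- msupp Q) modulus (mcoeff m Q) *
   (r ^+ m ord0 * r ^+ m X2)) => z zr.
rewrite evalXY_sum (le_trans (modulus_sum _ _))//.
apply: ler_sum => m _; rewrite !modulusM !modulusX.
have z1 := le_trans (modulus1_le_norm2 z) zr.
have z2 := le_trans (modulus2_le_norm2 z) zr.
have m1 := modulus_ge0 z.1; have m2 := modulus_ge0 z.2.
rewrite ler_wpM2l ?modulus_ge0// ler_pM ?exprn_ge0 ?lerXn2r//.
- by rewrite nnegrE (le_trans m1).
- by rewrite nnegrE (le_trans m2).
Qed.

Lemma lift_bounded_above (F : polyXY R * polyXY R) :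
  exists B, forall z, norm2 z = 1 -> norm2 (eval_lift F z) <= B.
Proof.
have [B1 FB1] := evalXY_bounded F.1 1; have [B2 FB2] := evalXY_bounded F.2 1.
exists (B1 + B2) => z z1.
have z1' : norm2 z <= 1 by rewrite z1.
have := FB1 _ z1'; have := FB2 _ z1'.
have := modulus_ge0 (evalXY F.1 z); have := modulus_ge0 (evalXY F.2 z).
by move=> h2 h1 h4 h3; apply: le_norm2 => /=; [lra|nra].
Qed.

Lemma evalXYM P Q z : evalXY (P * Q) z = evalXY P z * evalXY Q z.
Proof. exact: mevalM. Qed.

Lemma evalXYD P Q z : evalXY (P + Q) z = evalXY P z + evalXY Q z.
Proof. exact: mevalD. Qed.

Lemma evalXYZ c Q z : evalXY (c *: Q) z = c * evalXY Q z.
Proof. exact: mevalZ. Qed.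

Lemma evalXYX Q k z : evalXY (Q ^+ k) z = evalXY Q z ^+ k.
Proof. exact: rmorphXn. Qed.

Lemma evalXY_prod (I : finType) (f : I -> polyXY R) z :
  evalXY (\prod_i f i) z = \prod_i evalXY (f i) z.
Proof. exact: rmorph_prod. Qed.

Lemma evalXY_X z : evalXY (mpolyX R[i] (mnm1 ord0)) z = z.1.
Proof. exact: mevalXU. Qed.

Lemma evalXY_Y z : evalXY (mpolyX R[i] (mnm1 X2)) z = z.2.
Proof. exact: mevalXU. Qed.

(* Re and Im of a polynomial function lie in every class of real functions that
   is closed under ring operations and contains those of the coordinates. *)
Lemma evalXY_closed (X : Type) (p : X -> C2 R) (P : (X -> R) -> Prop) :
  (forall r : R, P (fun=> r)) ->
  (forall f g, P f -> P g -> P (fun x => f x + g x)) ->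
  (forall f g, P f -> P g -> P (fun x => f x * g x)) ->
  P (fun x => Re (p x).1) -> P (fun x => Im (p x).1) ->
  P (fun x => Re (p x).2) -> P (fun x => Im (p x).2) ->
  forall Q, P (fun x => Re (evalXY Q (p x))) /\ P (fun x => Im (evalXY Q (p x))).
Proof.
move=> Pc PD PM P1r P1i P2r P2i Q.
pose PC (h : X -> R[i]) := P (fun x => Re (h x)) /\ P (fun x => Im (h x)).
have PCc c : PC (fun=> c) by split; apply: Pc.
have PCD f g : PC f -> PC g -> PC (fun x => f x + g x).
  move=> [fr fi] [gr gi]; split.
  - have := PD _ _ fr gr; congr P; apply/funext => x.
    by case: (f x) (g x) => [? ?] [? ?].
  - have := PD _ _ fi gi; congr P; apply/funext => x.
    by case: (f x) (g x) => [? ?] [? ?].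
have PCM f g : PC f -> PC g -> PC (fun x => f x * g x).
  move=> [fr fi] [gr gi]; split.
  - have := PD _ _ (PM _ _ fr gr) (PM _ _ (Pc (-1)) (PM _ _ fi gi)).
    congr P; apply/funext => x.
    by case: (f x) (g x) => [? ?] [? ?] /=; rewrite mulN1r.
  - have := PD _ _ (PM _ _ fr gi) (PM _ _ fi gr).
    by congr P; apply/funext => x; case: (f x) (g x) => [? ?] [? ?].
have PCX f n : PC f -> PC (fun x => f x ^+ n).
  move=> Pf; elim: n => [|n IH]; first exact: PCc.
  by have := PCM _ _ Pf IH; congr PC; apply/funext => x; rewrite exprS.
rewrite -/(PC (fun x => evalXY Q (p x))).
under eq_fun do rewrite evalXY_sum.
elim: (msupp Q) => [|m s IH].
  by under eq_fun do rewrite big_nil; exact: PCc.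
under eq_fun do rewrite big_cons.
apply: (PCD) IH; apply: (PCM); first exact: PCc.
by apply: (PCM); apply: (PCX); split.
Qed.

End Norms.

(** * Unit quaternions as rotations of R^4 *)

Section Rotation.
Variable R : realType.

(* The matrix in real coordinates of (z1, z2) |-> (u z1 + v z2,
   - conj(v) z1 + conj(u) z2), with u = a + ib and v = c + id. *)
Definition quaternion_mx (a b c d : R) : 'M[R]_4 :=
  \matrix_(i < 4, j < 4)
   nth 0 (nth [::] [:: [:: a; - b; c; - d]; [:: b; a; d; c];
                    [:: - c; - d; a; b]; [:: d; - c; - b; a]] i) j.

Lemma quaternion_mx_orthogonal a b c d : a ^+ 2 + b ^+ 2 + c ^+ 2 + d ^+ 2 = 1 ->
  quaternion_mx a b c d *m (quaternion_mx a b c d)^T = 1%:M.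
Proof.
move=> h; apply/matrixP => i j; rewrite !mxE !big_ord_recl big_ord0 !mxE /=.
by move: i j; do 2![case; do 4?[case=> //]; move=> ?];
  rewrite /= ?mulr1n ?mulr0n -?h; ring.
Qed.

Lemma quaternion_mx_det a b c d : a ^+ 2 + b ^+ 2 + c ^+ 2 + d ^+ 2 = 1 ->
  \det (quaternion_mx a b c d) = 1.
Proof.
move=> h; suff -> : \det (quaternion_mx a b c d) =
  (a ^+ 2 + b ^+ 2 + c ^+ 2 + d ^+ 2) ^+ 2 by rewrite h expr1n.
rewrite (expand_det_row _ ord0) !big_ord_recl big_ord0 /cofactor.
do 2!rewrite !(expand_det_row _ ord0) !big_ord_recl !big_ord0 /cofactor.
rewrite !det_mx11 !mxE /= /bump /= !add0n ?addn0 /=.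
by ring.
Qed.
End Rotation.

(** * Integration over the sphere *)

Section Measurability.
Variable R : realType.
Local Notation T := (4.-tuple R).

Lemma measurable_modulus d (X : measurableType d) (h : X -> R[i]) :
  measurable_fun setT (fun x => Re (h x)) ->
  measurable_fun setT (fun x => Im (h x)) ->
  measurable_fun setT (fun x => modulus (h x)).
Proof.
move=> mr mi.
have -> : (fun x => modulus (h x)) =
    (@Num.sqrt R) \o (fun x => Re (h x) ^+ 2 + Im (h x) ^+ 2).
  by apply/funext => x /=; case: (h x).
apply: measurableT_comp.
  by apply: continuous_measurable_fun; exact: sqrt_continuous.
by apply: measurable_funD; apply: measurable_funX.
Qed.

Lemma measurable_coord (i : 'I_4) :
  measurable_fun setT (fun x : T => tnth x i).
Proof. exact: measurable_tnth. Qed.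

Lemma measurable_evalXY (Q : polyXY R) :
  measurable_fun setT (fun x : T => Re (evalXY Q (toC2 x))) /\
  measurable_fun setT (fun x : T => Im (evalXY Q (toC2 x))).
Proof.
pose P (f : T -> R) := measurable_fun setT f.
apply: (@evalXY_closed _ _ (@toC2 R) P); rewrite /P.
- by move=> r; exact: measurable_cst.
- by move=> f g; exact: measurable_funD.
- by move=> f g; exact: measurable_funM.
- exact: (measurable_coord i4_0).
- exact: (measurable_coord i4_1).
- exact: (measurable_coord i4_2).
- exact: (measurable_coord i4_3).
Qed.

Lemma measurable_modulus_evalXY (Q : polyXY R) :
  measurable_fun setT (fun x : T => modulus (evalXY Q (toC2 x))).
Proof. by have [mr mi] := measurable_evalXY Q; exact: measurable_modulus. Qed.

Lemma measurable_modulus_coord :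
  measurable_fun setT (fun x : T => modulus (toC2 x).1) /\
  measurable_fun setT (fun x : T => modulus (toC2 x).2).
Proof.
split; apply: measurable_modulus.
- exact: (measurable_coord i4_0).
- exact: (measurable_coord i4_1).
- exact: (measurable_coord i4_2).
- exact: (measurable_coord i4_3).
Qed.

Lemma measurable_norm2 : measurable_fun setT (fun x : T => norm2 (toC2 x)).
Proof.
have [m1 m2] := measurable_modulus_coord.
apply: (@measurableT_comp _ _ _ _ _ _ (@Num.sqrt R)).
  by apply: continuous_measurable_fun; exact: sqrt_continuous.
by apply: measurable_funD; apply: measurable_funX.
Qed.

Lemma measurable_norm2_lift (F : polyXY R * polyXY R) :
  measurable_fun setT (fun x : T => norm2 (eval_lift F (toC2 x))).
Proof.
apply: (@measurableT_comp _ _ _ _ _ _ (@Num.sqrt R)).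
  by apply: continuous_measurable_fun; exact: sqrt_continuous.
by apply: measurable_funD; apply: measurable_funX;
  exact: measurable_modulus_evalXY.
Qed.

Lemma measurable_modulus_dot_lift (F : polyXY R * polyXY R) :
  measurable_fun setT
    (fun p : T * T => modulus (dot (toC2 p.1) (eval_lift F (toC2 p.2)))).
Proof.
have [r1 i1] := measurable_evalXY F.1; have [r2 i2] := measurable_evalXY F.2.
have mc i : measurable_fun setT (fun p : T * T => tnth p.1 i).
  exact: (measurableT_comp (measurable_coord i) measurable_fst).
have mr1 : measurable_fun setT (fun p : T * T => Re (evalXY F.1 (toC2 p.2))).
  exact: (measurableT_comp r1 measurable_snd).
have mi1 : measurable_fun setT (fun p : T * T => Im (evalXY F.1 (toC2 p.2))).
  exact: (measurableT_comp i1 measurable_snd).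
have mr2 : measurable_fun setT (fun p : T * T => Re (evalXY F.2 (toC2 p.2))).
  exact: (measurableT_comp r2 measurable_snd).
have mi2 : measurable_fun setT (fun p : T * T => Im (evalXY F.2 (toC2 p.2))).
  exact: (measurableT_comp i2 measurable_snd).
apply: measurable_modulus.
- have := measurable_funD (measurable_funB (measurable_funM (mc i4_0) mr1)
    (measurable_funM (mc i4_1) mi1)) (measurable_funB (measurable_funM (mc i4_2) mr2)
    (measurable_funM (mc i4_3) mi2)).
  congr (measurable_fun _ _); apply/funext => p /=; rewrite /dot /eval_lift /=.
  by case: (evalXY F.1 _) (evalXY F.2 _) => [? ?] [? ?].
- have := measurable_funD (measurable_funD (measurable_funM (mc i4_0) mi1)
    (measurable_funM (mc i4_1) mr1)) (measurable_funD (measurable_funM (mc i4_2) mi2)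
    (measurable_funM (mc i4_3) mr2)).
  congr (measurable_fun _ _); apply/funext => p /=; rewrite /dot /eval_lift /=.
  by case: (evalXY F.1 _) (evalXY F.2 _) => [? ?] [? ?].
Qed.

Lemma measurable_dot (u : C2 R) :
  measurable_fun setT (fun x : T => modulus (dot u (toC2 x))).
Proof.
have := measurable_modulus_evalXY
  (u.1 *: mpolyX R[i] (mnm1 ord0) + u.2 *: mpolyX R[i] (mnm1 X2)).
congr (measurable_fun _ _); apply/funext => x.
by rewrite evalXYD !evalXYZ evalXY_X evalXY_Y.
Qed.

Lemma measurable_linear_act (A : 'M[R]_4) :
  measurable_fun setT (linear_act A).
Proof.
apply/measurable_fun_tnthP => i.
have -> : (@tnth 4 R)^~ i \o linear_act A =
    fun x => \sum_(j < 4) A i j * tnth x j.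
  by apply/funext => x /=; rewrite tnth_mktuple.
apply: measurable_sum => j; apply: measurable_funM => //.
exact: measurable_coord.
Qed.

Lemma measurable_lne : measurable_fun setT (fun t : R => lne t%:E).
Proof.
apply: measurable_fun_ifT => //=.
- exact: measurable_fun_ler.
- by apply/measurable_EFinP; exact: measurable_ln.
Qed.

Definition sphere : set T := @toC2 R @^-1` S3.

Lemma measurable_sphere : measurable sphere.
Proof.
have := @measurable_norm2 measurableT [set 1] (measurable_set1 1).
by rewrite setTI.
Qed.

End Measurability.

(** * Reduction of integrals in |u . z| to the first coordinate *)

Section Invariance.
Variable R : realType.
Local Notation T := (4.-tuple R).
Variable sigma : probability T R.
Hypothesis sigma_inv : rotation_invariant_on_S3 sigma.
Local Notation D := (@sphere R).
Local Open Scope ereal_scope.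

Lemma sigma_sphere : sigma D = 1.
Proof. by case: sigma_inv. Qed.

(** The complement of the sphere is a null set. Changes of variable and Tonelli can thus be carried
    out on the whole of R^4. *)
Lemma ge0_integral_sphere (f : T -> \bar R) : measurable_fun setT f ->
  (forall x, 0 <= f x) -> \int[sigma]_(x in D) f x = \int[sigma]_x f x.
Proof.
move=> mf f0; have mD := @measurable_sphere R.
rewrite [RHS](@ge0_negligible_integral _ _ _ _ _ (~` D))//.
- by rewrite setDE setCK setTI.
- exact: measurableC.
- by have := probability_setC sigma mD; rewrite sigma_sphere subee.
Qed.

Lemma integral_cst_sphere (c : \bar R) : \int[sigma]_(x in D) c = c.
Proof.
rewrite integral_cst; last exact: measurable_sphere.
by rewrite -[RHS]mule1; congr (_ * _); exact: sigma_sphere.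
Qed.

(** Every unit u is the first row of a matrix of SU(2), which acts on R^4 as an element of SO(4). *)
Lemma rotation_to_dot (u : C2 R) : (norm2 u = 1)%R ->
  exists A : 'M[R]_4, [/\ A *m A^T = 1%:M, (\det A = 1)%R &
    forall x : T, (toC2 (linear_act A x)).1 = dot u (toC2 x)].
Proof.
case: u => -[a b] [c d] u1.
have h : (a ^+ 2 + b ^+ 2 + c ^+ 2 + d ^+ 2 = 1)%R.
  by have := sqr_norm2 ((a +i* b)%C, (c +i* d)%C);
    rewrite u1 expr1n !sqr_modulus /= => ->; ring.
exists (quaternion_mx a b c d); split.
- exact: quaternion_mx_orthogonal.
- exact: quaternion_mx_det.
move=> x; rewrite /toC2 /dot /= !tnth_mktuple !big_ord_recl !big_ord0 !mxE /=.
rewrite !(tnth_nth 0%R) /= /bump /=.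
by apply/eqP; rewrite eq_complex /=; apply/andP; split; apply/eqP; ring.
Qed.

(** For a unit vector, a rotation carries [dot u] to the first coordinate; scaling reduces any
    nonzero u to that case. *)
Lemma integral_dot (g : R -> \bar R) (u : C2 R) :
  measurable_fun setT g -> (forall t, 0 <= g t) ->
  \int[sigma]_(x in D) g (modulus (dot u (toC2 x))) =
  \int[sigma]_(x in D) g (norm2 u * modulus (toC2 x).1)%R.
Proof.
move=> mg g0.
have mdot := @measurable_dot R.
have m1 := (@measurable_modulus_coord R).1.
rewrite !ge0_integral_sphere//; last 2 first.
- apply: (measurableT_comp mg); apply: measurable_funM => //.
- exact: (measurableT_comp mg).
have [u0|u0] := eqVneq (norm2 u) 0%R.
  apply: eq_integral => x _; rewrite u0 mul0r; congr g.
  by rewrite (norm2_eq0 u0) /dot /= !mul0r addr0; exact: modulus0.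
pose n := norm2 u.
pose u' : C2 R := ((n^-1)%:C%C * u.1, (n^-1)%:C%C * u.2)%R.
have n_gt0 : (0 < n)%R by rewrite lt_neqAle eq_sym u0 norm2_ge0.
have u'1 : norm2 u' = 1%R.
  by rewrite norm2_scale modulus_real ger0_norm ?invr_ge0 ?ltW// mulVf.
have [A [AA dA Ax]] := rotation_to_dot u'1.
have dotE z : (modulus (dot u z) = n * modulus (dot u' z))%R.
  have -> : (dot u' z = (n^-1)%:C%C * dot u z)%R by rewrite /dot /=; ring.
  by rewrite modulusM modulus_real ger0_norm ?invr_ge0 ?ltW// mulVKf// gt_eqF.
have mA := @measurable_linear_act R A.
(* Change of variables by A; invariance then says that the pushforward agrees with [sigma] on Borel
   sets. *)
transitivity (\int[pushforward sigma (linear_act A)]_y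
    g (n * modulus (toC2 y).1)%R).
  rewrite ge0_integral_pushforward//; last first.
    by apply: (measurableT_comp mg); apply: measurable_funM.
  by rewrite preimage_setT; apply: eq_integral => x _; rewrite dotE -Ax.
apply: eq_measure_integral => B mB _.
by case: sigma_inv => _; exact.
Qed.

End Invariance.

(** * Integrability of log |z1| *)

Section SmallBalls.
Variable R : realType.
Local Notation T := (4.-tuple R).
Variable sigma : probability T R.
Hypothesis sigma_inv : rotation_invariant_on_S3 sigma.
Local Notation D := (@sphere R).

Lemma measurable_dot_le (u : C2 R) (s : R) :
  measurable [set x : T | modulus (dot u (toC2 x)) <= s].
Proof.
have := measurable_dot u measurableT (measurable_itv `]-oo, s]).
by rewrite setTI; congr measurable; apply/seteqP; split => x /=; rewrite in_itv.
Qed.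

Lemma sigma_dot_le (u : C2 R) (s : R) :
  sigma ([set x | modulus (dot u (toC2 x)) <= s] `&` D) =
  sigma ([set x | norm2 u * modulus (toC2 x).1 <= s] `&` D).
Proof.
pose A := [set r : R | r <= s].
have mA : measurable A.
  by have := measurable_itv `]-oo, s]; congr measurable; apply/seteqP;
    split => x /=; rewrite in_itv.
have mg : measurable_fun setT (fun r : R => (\1_A r)%:E : \bar R).
  by apply/measurable_EFinP; exact: measurable_indic.
have mD := @measurable_sphere R.
have m2 : measurable [set x : T | norm2 u * modulus (toC2 x).1 <= s].
  have mf : measurable_fun setT (fun x : T => norm2 u * modulus (toC2 x).1).
    by apply: measurable_funM => //; exact: (@measurable_modulus_coord R).1.
  by have := mf measurableT A mA; rewrite setTI.
rewrite -(integral_indic sigma mD (measurable_dot_le u s)).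
rewrite -(integral_indic sigma mD m2).
by apply: (integral_dot sigma_inv u mg) => t; rewrite lee_fin.
Qed.

(* The strips |z1 + (j/N) z2| <= 2t, j < N, are disjoint on the sphere, and each
   has at least the measure of the strip |z1| <= t. *)
Lemma sigma_strip_le (N : nat) (t : R) : (0 < N)%N -> 0 <= t ->
  16 * N%:R * t <= 1 ->
  (sigma ([set x | (modulus (toC2 x).1 <= t)%R] `&` D) <= (N%:R^-1)%:E)%E.
Proof.
move=> N0 t0 Nt; have mD := @measurable_sphere R.
have N0' : 0 < N%:R :> R by rewrite ltr0n.
have ms : measurable [set x : T | modulus (toC2 x).1 <= t].
  have := measurable_dot_le (1, 0) t; congr measurable.
  by apply/seteqP; split => x /=; rewrite /dot /= mul1r mul0r addr0.
set S := _ `&` D; have mS : measurable S by exact: measurableI.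
pose w (j : nat) : C2 R := (1, (j%:R / N%:R)%:C%C).
pose C j := [set x : T | modulus (dot (w j) (toC2 x)) <= 2 * t] `&` D.
have mC j : measurable (C j) by apply: measurableI => //; exact: measurable_dot_le.
(* The norm of [w j] is at most 2, because j/N <= 1; this is why the strips [C j] have width 2t
   instead of t. *)
have SC j : (j < N)%N -> (sigma S <= sigma (C j))%E.
  move=> jN; rewrite /C sigma_dot_le; apply: le_measure.
  - by rewrite inE.
  - rewrite inE; apply: measurableI => //.
    have mf : measurable_fun setT
        (fun x : T => norm2 (w j) * modulus (toC2 x).1).
      by apply: measurable_funM => //; exact: (@measurable_modulus_coord R).1.
    have := mf measurableT _ (measurable_itv `]-oo, (2 * t)%R]).
    by rewrite setTI; congr measurable; apply/seteqP; split => x /=; rewrite in_itv.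
  - move=> x /= [xt Dx]; split => //=.
    apply: ler_pM => //; rewrite ?norm2_ge0 ?modulus_ge0//.
    apply: le_norm2 => //=; rewrite modulus1 modulus_real ger0_norm; last first.
      by rewrite divr_ge0.
    have : j%:R / N%:R <= 1 :> R.
      by rewrite ler_pdivrMr// mul1r ler_nat ltnW.
    have : 0 <= j%:R / N%:R :> R by rewrite divr_ge0.
    by nra.
have tC : trivIset `I_N C.
  apply/trivIsetP => i j /= iN jN ij; rewrite -subset0 => x [[/= xi Dx] [/= xj _]].
  move: Dx; rewrite /sphere /S3 /= => Dx.
  have [a0 b0] := (modulus_ge0 (toC2 x).1, modulus_ge0 (toC2 x).2).
  have := sqr_norm2 (toC2 x); rewrite Dx expr1n.
  move: xi xj a0 b0; case: (toC2 x) => z1 z2 /= xi xj a0 b0 nz.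
  wlog ltij : i j iN jN ij xi xj / (j < i)%N.
    move=> H; have [h|h|h] := ltngtP i j; last by rewrite h eqxx in ij.
    - by apply: (H j i) => //; rewrite eq_sym.
    - exact: (H i j).
  (* In a common point the difference of the two forms is ((i - j)/N) z2, of modulus at most 4t, and
     i - j >= 1. With 16 N t <= 1 this leaves |z2| <= 1/4 and |z1| <= 3/8, too small for the unit
     sphere. *)
  have h2 : modulus z2 <= 4 * t * N%:R.
    have e : (((i%:R - j%:R) / N%:R)%:C%C : R[i]) * z2 =
        dot (w i) (z1, z2) - dot (w j) (z1, z2).
      by rewrite /dot /= mulrBl rmorphB /=; ring.
    have : modulus (((i%:R - j%:R) / N%:R)%:C%C * z2 : R[i]) <= 4 * t.
      rewrite e (le_trans (modulusD _ _))// modulusN.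
      by lra.
    rewrite modulusM modulus_real ger0_norm; last first.
      by rewrite divr_ge0// subr_ge0 ler_nat ltnW.
    rewrite mulrAC ler_pdivrMr//; apply: le_trans.
    by rewrite ler_peMl// -natrB 1?ltnW// ler1n subn_gt0.
  have h1 : modulus z1 <= 2 * t + modulus z2.
    have -> : z1 = dot (w i) (z1, z2) - (i%:R / N%:R)%:C%C * z2.
      by rewrite /dot /=; ring.
    rewrite (le_trans (modulusD _ _))// modulusN.
    rewrite lerD// modulusM modulus_real ger0_norm ?divr_ge0//.
    by rewrite ler_piMl// ler_pdivrMr// mul1r ler_nat ltnW.
  have N1 : 1 <= N%:R :> R by rewrite ler1n.
  by nra.
have le1 : (\sum_(i < N) sigma (C i) <= 1)%E.
  by rewrite -measure_semi_additive_ord_I// ?probability_le1//; exact: bigsetU_measurable.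
have fS : sigma S \is a fin_num by exact: fin_num_measure.
rewrite -(fineK fS) lee_fin -[leRHS]mul1r ler_pdivlMr// -lee_fin.
apply: le_trans le1; rewrite mulr_natr -[X in _ *+ X]card_ord -sumr_const -sumEFin.
by apply: lee_sum => j _; rewrite fineK//; exact: SC.
Qed.

(* A dyadic majorant, up to a constant, of the function 1 / sqrt t. *)
Definition layer (t : R) : \bar R :=
  (\sum_(n <oo) ((2 ^ n.+1)%:R * \1_[set r : R | r <= 4^-1 ^+ n] t : R)%:E)%E.

Lemma layer_term_ge0 n (t : R) :
  (0 <= ((2 ^ n.+1)%:R * \1_[set r : R | r <= 4^-1 ^+ n] t : R)%:E)%E.
Proof. by rewrite lee_fin mulr_ge0. Qed.

Lemma layer_ge0 t : (0 <= layer t)%E.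
Proof. by apply: nneseries_ge0 => n _ _; exact: layer_term_ge0. Qed.

Lemma layer_ge n (t : R) : t <= 4^-1 ^+ n -> ((2 ^ n.+1)%:R%:E <= layer t)%E.
Proof.
move=> tn; apply: le_trans (nneseries_lim_ge n.+1 _); last first.
  by move=> k _ _; exact: layer_term_ge0.
rewrite big_nat_recr//= indicE mem_set// mulr1 leeDr// sume_ge0//.
Qed.

Lemma measurable_le_set (s : R) : measurable [set r : R | r <= s].
Proof.
by have := measurable_itv `]-oo, s]; congr measurable; apply/seteqP;
  split => x /=; rewrite in_itv.
Qed.

Lemma measurable_layer : measurable_fun setT layer.
Proof.
apply: ge0_emeasurable_sum => [n r _ _|n _]; first exact: layer_term_ge0.
apply/measurable_EFinP; apply: measurable_funM => //.
by apply: measurable_indic; exact: measurable_le_set.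
Qed.

Lemma integral_layer :
  exists2 K : R, 0 < K &
  (\int[sigma]_(x in D) layer (modulus (toC2 x).1) <= K%:E)%E.
Proof.
exists 64; first by rewrite ltr0n.
have mD := @measurable_sphere R.
have mS n : measurable [set x : T | modulus (toC2 x).1 <= 4^-1 ^+ n].
  have := (@measurable_modulus_coord R).1 measurableT _
    (measurable_le_set (4^-1 ^+ n)).
  by rewrite setTI.
rewrite integral_nneseries//; last first.
- move=> n; apply: measurable_funTS; apply/measurable_EFinP.
  apply: measurable_funM => //.
  by apply: (@measurable_indic _ _ _ _ [set x : T | modulus (toC2 x).1 <= 4^-1 ^+ n]).
have e0 : 0 <= 64 :> R by rewrite ler0n.
(* The n-th term is compared with 64 / 2^(n+1): the weight is 2^(n+1), and the strip |z1| <= 4^-n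
   has measure at most 16 / 4^n. *)
apply: le_trans (epsilon_trick0 xpredT e0).
apply: lee_nneseries => [n _ _|n _].
  by apply: integral_ge0 => x _; exact: layer_term_ge0.
under eq_integral do rewrite EFinM.
rewrite ge0_integralZl//; last first.
- apply: measurable_funTS; apply/measurable_EFinP.
  by apply: (@measurable_indic _ _ _ _ [set x : T | modulus (toC2 x).1 <= 4^-1 ^+ n]).
rewrite -[X in (_ * X)%E]/(\int[sigma]_(x in D)
  (\1_[set x | modulus (toC2 x).1 <= 4^-1 ^+ n] x)%:E)%E.
rewrite integral_indic//.
(* For n >= 2 this is [sigma_strip_le] with N = 4^(n-2) and t = 4^-n, where 16 N t = 1. For n < 2
   the bound exceeds the total mass. *)
apply: (@le_trans _ _ ((2 ^ n.+1)%:R%:E * (16 * 4^-1 ^+ n)%:E)%E).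
  rewrite lee_wpmul2l// ?lee_fin//.
  have [n2|n2] := ltnP n 2.
    apply: (@le_trans _ _ 1%E); first exact: probability_le1 (measurableI _ _ _ _).
    rewrite lee_fin; case: n n2 {mS} => [_|[|//]]; rewrite ?expr0 ?expr1; lra.
  have -> : 16 * 4^-1 ^+ n = ((4 ^ (n - 2))%:R)^-1 :> R.
    rewrite -{1}(subnK n2) exprD natrX exprVn.
    have h : (4 : R) ^+ (n - 2) != 0 by rewrite expf_neq0// pnatr_eq0.
    by field.
  apply: sigma_strip_le; rewrite ?expn_gt0//.
  rewrite -{2}(subnK n2) exprD natrX exprVn.
  have h : (4 : R) ^+ (n - 2) != 0 by rewrite expf_neq0// pnatr_eq0.
  rewrite le_eqVlt; apply/orP; left; apply/eqP.
  by field.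
rewrite -EFinM lee_fin ler_pdivlMr ?ltr0n ?expn_gt0//.
rewrite !natrX exprS exprVn.
have -> : (4 : R) = 2 * 2 by lra.
rewrite exprMn.
have : (2 : R) ^+ n != 0 by rewrite expf_neq0// pnatr_eq0.
move: (2 ^+ n) => c c0.
have -> : 2 * c * (16 * (c * c)^-1) * (2 * c) = 64 by field.
lra.
Qed.

End SmallBalls.

(** * The logarithm, its regularization, and their integrals *)

Section LogEstimates.
Variable R : realType.
Local Notation T := (4.-tuple R).
Variable sigma : probability T R.
Hypothesis sigma_inv : rotation_invariant_on_S3 sigma.
Local Notation D := (@sphere R).

(* Nonnegative, so that integrals of nlog need no integrability assumption; it
   is - ln t on ]0, 1] and +oo at 0. *)
Definition nlog (t : R) : \bar R := maxe 0%E (- lne t%:E)%E.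

(* The regularization - ln (t + d) of - ln t, shifted to be nonnegative on
   [0, 1]. *)
Definition reglog (d t : R) : \bar R := maxe 0%E (ln 2 - ln (t + d))%:E.

Lemma nlog_ge0 t : (0 <= nlog t)%E.
Proof. by rewrite /nlog le_max lexx. Qed.

Lemma reglog_ge0 d t : (0 <= reglog d t)%E.
Proof. by rewrite /reglog le_max lexx. Qed.

Lemma measurable_nlog : measurable_fun setT nlog.
Proof.
apply: measurable_maxe; first exact: measurable_cst.
exact: (measurableT_comp (@oppe_measurable _ _) (@measurable_lne R)).
Qed.

Lemma measurable_reglog d : measurable_fun setT (reglog d).
Proof.
apply: measurable_maxe; first exact: measurable_cst.
apply/measurable_EFinP; apply: measurable_funB => //.
apply: (measurableT_comp (@measurable_ln R)).
exact: measurable_funD.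
Qed.

Lemma nlogE t : t <= 1 -> nlog t = (- lne t%:E)%E.
Proof.
by move=> t1; rewrite /nlog; apply/max_idPr; rewrite oppe_ge0 lne_le0 lee_fin.
Qed.

Lemma nlog_gt0E t : 0 < t -> t <= 1 -> nlog t = (- ln t)%:E.
Proof. by move=> t0 t1; rewrite nlogE// lne_EFin. Qed.

Lemma reglogE d t : 0 <= t -> 0 < d -> t + d <= 2 ->
  reglog d t = (ln 2 - ln (t + d))%:E.
Proof.
move=> t0 d0 td; rewrite /reglog; apply/max_idPr; rewrite lee_fin subr_ge0.
by rewrite ler_ln// ?posrE//; lra.
Qed.

Lemma pow2_unbounded (x : R) : exists n : nat, x <= 2 ^+ n.
Proof.
exists (Num.bound x); apply: ltW.
have := @upper_nthrootP R x (Num.bound x) (leqnn _); exact.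
Qed.

Lemma layer_le0 (t : R) : t <= 0 -> layer t = +oo%E.
Proof.
move=> t0; apply/eqyP => A A0.
have [n An] := pow2_unbounded A.
have tn : t <= 4^-1 ^+ n by rewrite (le_trans t0)// exprn_ge0// invr_ge0.
apply: le_trans (layer_ge tn); rewrite lee_fin natrX exprS.
by apply: (le_trans An); rewrite ler_peMl ?exprn_ge0// ler1n.
Qed.

(** With n + 1 the least index such that 4^-(n+1) < t, take c = 2^(n+1): the n-th term of [layer] is
    active and t * 4^(n+1) > 1. So [layer] majorizes 1 / sqrt t. *)
Lemma layer_bound (t : R) : 0 < t -> t <= 1 ->
  exists c : R, [/\ 0 < c, (c%:E <= layer t)%E & 1 <= t * c ^+ 2].
Proof.
move=> t0 t1.
have ex : exists n, 4^-1 ^+ n < t.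
  have [n tn] := pow2_unbounded (t^-1 + 1); exists n.
  rewrite exprVn invf_plt ?posrE ?exprn_gt0//.
  apply: (@lt_le_trans _ _ (2 ^+ n)); first by lra.
  by rewrite lerXn2r// ?nnegrE//; lra.
case: (ex_minnP ex) => -[|n] nt minn; first by move: nt; rewrite expr0; lra.
have tn : t <= 4^-1 ^+ n by rewrite leNgt; apply/negP => /minn; rewrite ltnn.
exists ((2 ^ n.+1)%:R); split; [by rewrite ltr0n expn_gt0|exact: layer_ge|].
have -> : ((2 ^ n.+1)%:R ^+ 2 : R) = 4 ^+ n.+1.
  by rewrite natrX -exprM mulnC exprM; congr (_ ^+ _); lra.
by rewrite -ler_pdivrMr ?exprn_gt0// mul1r -exprVn ltW.
Qed.

(** From t c^2 >= 1 follows - ln t <= 2 ln c <= 2 c. *)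
Lemma nlog_le_layer t : 0 <= t -> t <= 1 -> (nlog t <= 2%:E * layer t)%E.
Proof.
rewrite le_eqVlt => /predU1P[<- _|t0 t1].
  by rewrite (layer_le0 (lexx 0)) gt0_muley ?leey// lte_fin.
have [c [c0 cl tc]] := layer_bound t0 t1.
apply: (@le_trans _ _ (2%:E * c%:E)%E); last by rewrite lee_wpmul2l// lee_fin.
rewrite nlog_gt0E// -EFinM lee_fin.
have : 0 <= ln (t * c ^+ 2) by rewrite ln_ge0.
rewrite lnM ?posrE ?exprn_gt0// lnXn// mulr2n.
by have := ln_sublinear c0; lra.
Qed.

(** With c from [layer_bound], e^2 <= e^2 t c^2 gives t + e^2 <= t (1 + e c)^2, so the
    regularization by e^2 costs at most 2 ln (1 + e c) <= 2 e c. This is an explicit substitute for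
    a limit theorem as e tends to 0. *)
Lemma nlog_le_reglog e t : 0 <= t -> t <= 1 -> 0 < e -> e <= 1 ->
  ((ln 2)%:E + nlog t <= reglog (e ^+ 2) t + (2 * e)%:E * layer t)%E.
Proof.
move=> t0 t1 e0 e1; move: t0; rewrite le_eqVlt => /predU1P[<-|t0].
  rewrite (layer_le0 (lexx 0)) gt0_muley ?lte_fin ?mulr_gt0//.
  by rewrite addey ?leey// gt_eqF// (lt_le_trans _ (reglog_ge0 _ _))// ltNy0.
have [c [c0 cl tc]] := layer_bound t0 t1.
have e2 : 0 < e ^+ 2 by rewrite exprn_gt0.
apply: (@le_trans _ _ (reglog (e ^+ 2) t + (2 * e)%:E * c%:E)%E); last first.
  by rewrite leeD2l// lee_wpmul2l// lee_fin mulr_ge0// ltW.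
rewrite nlog_gt0E// reglogE//; [|exact: ltW|nra].
rewrite -EFinM -!EFinD lee_fin.
have ec : 0 < 1 + e * c by rewrite addr_gt0 ?mulr_gt0.
have : ln (t + e ^+ 2) <= ln (t * (1 + e * c) ^+ 2).
  rewrite ler_ln ?posrE ?addr_gt0 ?mulr_gt0 ?exprn_gt0//.
  have -> : t * (1 + e * c) ^+ 2 = t + 2 * (t * (e * c)) + e ^+ 2 * (t * c ^+ 2).
    by ring.
  have h1 : 0 <= t * (e * c) by rewrite !mulr_ge0// ltW.
  have h2 : e ^+ 2 <= e ^+ 2 * (t * c ^+ 2) by rewrite ler_peMr// ltW.
  by lra.
rewrite lnM ?posrE ?exprn_gt0// lnXn// mulr2n.
have : ln (1 + e * c) <= e * c by rewrite le_ln1Dx// (lt_trans _ (mulr_gt0 _ _)).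
by lra.
Qed.

(** This is J: on the sphere |z1| <= 1, so [nlog] is minus the logarithm there. *)
Definition nlog_coord : R := fine (\int[sigma]_(x in D) nlog (modulus (toC2 x).1))%E.

Lemma sphere_norm (x : T) : D x -> norm2 (toC2 x) = 1.
Proof. by []. Qed.

Lemma sphere_modulus1 (x : T) : D x -> modulus (toC2 x).1 <= 1.
Proof. by move=> /sphere_norm <-; exact: modulus1_le_norm2. Qed.

Let mD := @measurable_sphere R.
Let m1 := (@measurable_modulus_coord R).1.

(** Finiteness of J, from the integrable majorant 2 [layer]; [fine] therefore returns no default
    value. *)
Lemma integral_nlog_coord :
  (\int[sigma]_(x in D) nlog (modulus (toC2 x).1) = nlog_coord%:E)%E.
Proof.
rewrite fineK// ge0_fin_numE; last by apply: integral_ge0 => x _; exact: nlog_ge0.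
have [K K0 intK] := integral_layer sigma_inv.
apply: (@le_lt_trans _ _ (2%:E * K%:E)%E); last by rewrite ltry.
apply: (@le_trans _ _ (\int[sigma]_(x in D) (2%:E * layer (modulus (toC2 x).1)))%E).
  apply: ge0_le_integral => //.
  - by move=> x _; exact: nlog_ge0.
  - by apply: measurable_funTS; exact: (measurableT_comp measurable_nlog).
  - apply: measurable_funTS; apply: measurable_funeM.
    exact: (measurableT_comp (@measurable_layer R)).
  - by move=> x /sphere_modulus1; apply: nlog_le_layer; exact: modulus_ge0.
rewrite ge0_integralZl//.
- by rewrite lee_wpmul2l.
- by apply: measurable_funTS; exact: (measurableT_comp (@measurable_layer R)).
- by move=> x _; exact: layer_ge0.
Qed.

(** [nlog_le_reglog] is integrated with e so small that 2 e K <= eps, where K bounds the integral of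
    [layer]; then d = e^2. *)
Lemma integral_reglog_coord (eps : R) : 0 < eps -> exists2 d : R, 0 < d <= 1 &
  ((ln 2 + nlog_coord - eps)%:E <=
   \int[sigma]_(x in D) reglog d (modulus (toC2 x).1))%E.
Proof.
move=> eps0; have [K K0 intK] := integral_layer sigma_inv.
pose e := Num.min 1 (eps / (2 * K)).
have e0 : 0 < e by rewrite lt_min ltr01 divr_gt0// mulr_gt0.
have e1 : e <= 1 by rewrite ge_min lexx.
have e2 : 2 * e * K <= eps.
  have : e <= eps / (2 * K) by rewrite ge_min lexx orbT.
  by rewrite ler_pdivlMr ?mulr_gt0//; lra.
exists (e ^+ 2); first by rewrite exprn_gt0//= exprn_ile1// ltW.
rewrite EFinB leeBlDr// EFinD.
have ml := measurableT_comp (@measurable_layer R) m1.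
have mr := measurableT_comp (measurable_reglog (e ^+ 2)) m1.
have mn := measurableT_comp measurable_nlog m1.
have -> : ((ln 2)%:E + nlog_coord%:E =
    \int[sigma]_(x in D) ((ln 2)%:E + nlog (modulus (toC2 x).1)))%E.
  rewrite ge0_integralD//.
  - by rewrite integral_cst_sphere// integral_nlog_coord.
  - by move=> x _; rewrite lee_fin ln_ge0// ler1n.
  - by move=> x _; exact: nlog_ge0.
  - exact: measurable_funTS.
apply: (@le_trans _ _ (\int[sigma]_(x in D) (reglog (e ^+ 2) (modulus (toC2 x).1)
     + (2 * e)%:E * layer (modulus (toC2 x).1)))%E).
  apply: ge0_le_integral => //.
  - by move=> x _; rewrite adde_ge0 ?nlog_ge0// lee_fin ln_ge0// ler1n.
  - by apply: measurable_funTS; apply: emeasurable_funD.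
  - by apply: measurable_funTS; apply: emeasurable_funD => //; exact: measurable_funeM.
  - move=> x /sphere_modulus1 x1; apply: nlog_le_reglog => //; exact: modulus_ge0.
rewrite ge0_integralD//; last 4 first.
- by move=> x _; exact: reglog_ge0.
- exact: measurable_funTS.
- by move=> x _; rewrite mule_ge0 ?layer_ge0// lee_fin mulr_ge0// ltW.
- by apply: measurable_funTS; exact: measurable_funeM.
rewrite leeD2l// ge0_integralZl//.
- apply: (@le_trans _ _ ((2 * e)%:E * K%:E)%E); last by rewrite lee_fin.
  by rewrite lee_wpmul2l// lee_fin mulr_ge0// ltW.
- exact: measurable_funTS.
- by move=> x _; exact: layer_ge0.
- by rewrite lee_fin mulr_ge0// ltW.
Qed.

End LogEstimates.

(** * Finite logarithmic integrals and their additivity *)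

Section LogIntegral.
Variable R : realType.
Local Notation T := (4.-tuple R).
Variable sigma : probability T R.
Hypothesis sigma_inv : rotation_invariant_on_S3 sigma.
Local Notation D := (@sphere R).
Let mD := @measurable_sphere R.

(* No integrability is needed: the conventions for differences of infinite
   extended reals are compatible with the order. *)
Lemma le_integral_sphere (f g : T -> \bar R) :
  measurable_fun setT f -> measurable_fun setT g ->
  (forall x, D x -> (f x <= g x)%E) ->
  (\int[sigma]_(x in D) f x <= \int[sigma]_(x in D) g x)%E.
Proof.
move=> mf mg fg; rewrite integralE [leRHS]integralE; apply: leeB.
- apply: ge0_le_integral => //.
  + by apply: measurable_funTS; exact: measurable_funepos.
  + by apply: measurable_funTS; exact: measurable_funepos.
  + by move=> x Dx; rewrite unlock ge_max !le_max lexx orbT fg.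
- apply: ge0_le_integral => //.
  + by apply: measurable_funTS; exact: measurable_funeneg.
  + by apply: measurable_funTS; exact: measurable_funeneg.
  + by move=> x Dx; rewrite unlock ge_max !le_max lexx orbT leeN2 fg ?orbT.
Qed.

(** No indeterminate sum arises: [lne] of a real number is never +oo, so a zero factor makes both
    sides -oo. *)
Lemma lne_mul (a b : R) : 0 <= a -> 0 <= b ->
  lne (a * b)%:E = (lne a%:E + lne b%:E)%E.
Proof.
rewrite le_eqVlt => /predU1P[<- _|a0]; first by rewrite mul0r le0_lneNy.
rewrite le_eqVlt => /predU1P[<-|b0].
  by rewrite mulr0 (@le0_lneNy _ 0%:E)// addeNy.
by rewrite !lne_EFin ?mulr_gt0// lnM.
Qed.

(** Integrability is recorded with the value so that integrals can be added. *)
Definition log_integral (h : T -> R) (s : R) : Prop :=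
  sigma.-integrable D (fun x => lne (h x)%:E) /\
  (\int[sigma]_(x in D) lne (h x)%:E = s%:E)%E.

Lemma eq_log_integral (h1 h2 : T -> R) (s : R) :
  (forall x, D x -> h1 x = h2 x) -> log_integral h1 s -> log_integral h2 s.
Proof.
move=> h12 [i1 e1]; have E : {in D, (fun x => lne (h1 x)%:E) =1
    (fun x => lne (h2 x)%:E)} by move=> x; rewrite inE => Dx; rewrite h12.
by split; [exact: eq_integrable i1|rewrite -e1; apply/esym/eq_integral].
Qed.

(** Since h / M <= 1, log h is ln M minus the nonnegative function [nlog] of h / M, whose integral
    is assumed finite. *)
Lemma log_integral_nlog (h : T -> R) (M s : R) :
  measurable_fun setT h -> 0 < M -> (forall x, D x -> 0 <= h x <= M) ->
  (\int[sigma]_(x in D) nlog (h x / M) = s%:E)%E -> log_integral h (ln M - s).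
Proof.
move=> mh M0 hM ints.
have mn : measurable_fun setT (fun x => nlog (h x / M)).
  by apply: (measurableT_comp (@measurable_nlog R)); exact: measurable_funM.
have E x : D x -> lne (h x)%:E = ((ln M)%:E - nlog (h x / M))%E.
  move=> /hM /andP[h0 h1].
  rewrite nlogE ?ler_pdivrMr ?mul1r// oppeK -(lne_EFin M0) -lne_mul ?divr_ge0 ?(ltW M0)//.
  by rewrite mulrC divfK// gt_eqF.
have ic : sigma.-integrable D (cst (ln M)%:E).
  by apply: finite_measure_integrable_cst.
have inn : sigma.-integrable D (fun x => nlog (h x / M)).
  apply/integrableP; split; first exact: measurable_funTS.
  under eq_integral do rewrite gee0_abs ?nlog_ge0//.
  by rewrite ints ltry.
split.
  have := integrableB mD ic inn; apply: eq_integrable => // x.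
  by rewrite inE => Dx; rewrite E.
have -> : (\int[sigma]_(x in D) lne (h x)%:E =
    \int[sigma]_(x in D) ((ln M)%:E - nlog (h x / M)))%E.
  by apply: eq_integral => x; rewrite inE => Dx; rewrite E.
by rewrite integralB// integral_cst_sphere// ints.
Qed.

Lemma log_integral_cst (c : R) : 0 < c -> log_integral (fun=> c) (ln c).
Proof.
move=> c0; rewrite /log_integral lne_EFin//.
by rewrite integral_cst_sphere//; split => //; exact: finite_measure_integrable_cst.
Qed.

Lemma log_integralM (h1 h2 : T -> R) (s1 s2 : R) :
  (forall x, 0 <= h1 x) -> (forall x, 0 <= h2 x) ->
  log_integral h1 s1 -> log_integral h2 s2 ->
  log_integral (fun x => h1 x * h2 x) (s1 + s2).
Proof.
move=> h10 h20 [i1 e1] [i2 e2]; rewrite /log_integral.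
have -> : (fun x => lne (h1 x * h2 x)%:E) =
    (fun x => lne (h1 x)%:E + lne (h2 x)%:E)%E.
  by apply/funext => x; rewrite lne_mul.
by split; [exact: integrableD|rewrite integralD// e1 e2].
Qed.

Lemma log_integralX (h : T -> R) (s : R) (n : nat) :
  (forall x, 0 <= h x) -> log_integral h s ->
  log_integral (fun x => h x ^+ n) (n%:R * s).
Proof.
move=> h0 hs; elim: n => [|n IH].
  by rewrite mul0r -ln1; exact: log_integral_cst.
rewrite -natr1 mulrDl mul1r addrC.
have -> : (fun x => h x ^+ n.+1) = (fun x => h x * h x ^+ n).
  by apply/funext => x; rewrite exprS.
by apply: log_integralM => // x; exact: exprn_ge0.
Qed.

Lemma log_integral_prod (I : Type) (r : seq I) (h : I -> T -> R) (s : I -> R) :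
  (forall i x, 0 <= h i x) -> (forall i, log_integral (h i) (s i)) ->
  log_integral (fun x => \prod_(i <- r) h i x) (\sum_(i <- r) s i).
Proof.
move=> h0 hs; elim: r => [|i r IH].
  rewrite big_nil -ln1; under eq_fun do rewrite big_nil.
  exact: log_integral_cst.
rewrite big_cons; under eq_fun do rewrite big_cons.
by apply: log_integralM => // x; exact: prodr_ge0.
Qed.

Lemma log_integral_coord :
  log_integral (fun x => modulus (toC2 x).1) (- nlog_coord sigma).
Proof.
rewrite -[X in log_integral _ X]add0r -ln1; apply: log_integral_nlog => //.
- exact: (@measurable_modulus_coord R).1.
- by move=> x Dx; rewrite modulus_ge0 sphere_modulus1.
- by under eq_integral do rewrite divr1; exact: integral_nlog_coord.
Qed.

(** The nonnegative integrand is at most ln M' - ln c. Both forms of the result are kept: [nlog] for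
    Tonelli, [log_integral] for additivity. *)
Lemma log_integral_bounded (h : T -> R) (c M : R) :
  measurable_fun setT h -> 0 < c -> (forall x, D x -> c <= h x <= M) ->
  exists M' N, [/\ 0 < M', (forall x, D x -> h x <= M'),
    (\int[sigma]_(x in D) nlog (h x / M') = N%:E)%E &
    log_integral h (ln M' - N)].
Proof.
move=> mh c0 hcM.
(* The maximum with 1 gives M' > 0 without exhibiting a point of the sphere. *)
pose M' := Num.max 1 M.
have M0 : 0 < M' by rewrite lt_max ltr01.
have hcM' x : D x -> c <= h x <= M'.
  by move=> /hcM /andP[-> hM]; rewrite le_max hM orbT.
have fin : (\int[sigma]_(x in D) nlog (h x / M') \is a fin_num)%E.
  rewrite ge0_fin_numE; last by apply: integral_ge0 => x _; exact: nlog_ge0.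
  apply: (@le_lt_trans _ _ (ln M' - ln c)%:E); last by rewrite ltry.
  rewrite -[leRHS](integral_cst_sphere sigma_inv).
  apply: le_integral_sphere; last 1 first.
  - move=> x /hcM' /andP[ch hM].
    have h0 := lt_le_trans c0 ch.
    rewrite nlog_gt0E ?divr_gt0 ?ler_pdivrMr ?mul1r// lee_fin ln_div// opprB.
    by rewrite lerD2l lerN2 ler_ln.
  - by apply: (measurableT_comp (@measurable_nlog R)); exact: measurable_funM.
  - exact: measurable_cst.
exists M', (fine (\int[sigma]_(x in D) nlog (h x / M'))%E).
have intN := esym (fineK fin).
split => //; first by move=> x /hcM' /andP[].
apply: log_integral_nlog => //.
by move=> x /hcM' /andP[ch ->]; rewrite (ltW (lt_le_trans c0 ch)).
Qed.

End LogIntegral.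

(** * Equidistributed points *)

Section Averaging.
Variable R : realType.
Local Notation T := (4.-tuple R).
Variable sigma : probability T R.
Hypothesis sigma_inv : rotation_invariant_on_S3 sigma.
Local Notation D := (@sphere R).
Let mD := @measurable_sphere R.

Lemma dotC (w z : C2 R) : dot w z = dot z w.
Proof. by rewrite /dot; ring. Qed.

(** Both factors are at most 1, where [nlog] is not truncated; at 0 both sides are +oo. *)
Lemma nlogM (a b : R) : 0 <= a -> a <= 1 -> 0 <= b -> b <= 1 ->
  nlog (a * b) = (nlog a + nlog b)%E.
Proof.
have nlog0 : nlog (0 : R) = +oo%E by rewrite nlogE// le0_lneNy.
have nNy t : nlog t != -oo%E by rewrite gt_eqF// (lt_le_trans ltNy0)// nlog_ge0.
rewrite le_eqVlt => /predU1P[<- _|a0 a1]; first by rewrite mul0r nlog0 addye ?nNy.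
rewrite le_eqVlt => /predU1P[<- _|b0 b1]; first by rewrite mulr0 nlog0 addey ?nNy.
have ab1 : a * b <= 1 by rewrite mulr_ile1// ltW.
rewrite (nlog_gt0E (mulr_gt0 a0 b0) ab1) (nlog_gt0E a0 a1) (nlog_gt0E b0 b1).
by rewrite lnM ?posrE// opprD.
Qed.

Variables (F : polyXY R * polyXY R) (M N : R).
Hypothesis M0 : 0 < M.
Hypothesis FM : forall x, D x -> norm2 (eval_lift F (toC2 x)) <= M.
Hypothesis intF :
  (\int[sigma]_(x in D) nlog (norm2 (eval_lift F (toC2 x)) / M) = N%:E)%E.

(* ln M - potential w is the integral of log |w . F|. *)
Definition potential (w : T) : \bar R :=
  (\int[sigma]_(x in D) nlog (modulus (dot (toC2 w) (eval_lift F (toC2 x))) / M))%E.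

Let k (p : T * T) : \bar R :=
  nlog (modulus (dot (toC2 p.1) (eval_lift F (toC2 p.2))) / M).

Let mk : measurable_fun setT k.
Proof.
apply: (measurableT_comp (@measurable_nlog R)); apply: measurable_funM => //.
exact: measurable_modulus_dot_lift.
Qed.

Let k0 p : (0 <= k p)%E. Proof. exact: nlog_ge0. Qed.

Let potentialE w : potential w = (\int[sigma]_x k (w, x))%E.
Proof.
rewrite -(ge0_integral_sphere sigma_inv)//.
exact: (measurableT_comp mk (pair1_measurable w)).
Qed.

Lemma measurable_potential : measurable_fun setT potential.
Proof.
have -> : potential = (fun w => \int[sigma]_x k (w, x))%E.
  by apply/funext => w; exact: potentialE.
by apply: (@measurable_fun_fubini_tonelli_F _ _ _ _ _ sigma k).
Qed.

Lemma potential_ge0 w : (0 <= potential w)%E.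
Proof. by apply: integral_ge0 => x _; exact: nlog_ge0. Qed.

Lemma integral_potential :
  (\int[sigma]_(w in D) potential w = (N + nlog_coord sigma)%:E)%E.
Proof.
rewrite (ge0_integral_sphere sigma_inv); last 2 first.
- exact: measurable_potential.
- exact: potential_ge0.
under eq_integral do rewrite potentialE.
rewrite (@fubini_tonelli _ _ _ _ _ sigma sigma k)//.
rewrite -(ge0_integral_sphere sigma_inv); last 2 first.
- by apply: (@measurable_fun_fubini_tonelli_G _ _ _ _ _ sigma k).
- by move=> x; apply: integral_ge0.
transitivity (\int[sigma]_(x in D)
    (nlog (norm2 (eval_lift F (toC2 x)) / M) + (nlog_coord sigma)%:E))%E.
  apply: eq_integral => x; rewrite inE => Dx.
  rewrite -(ge0_integral_sphere sigma_inv)//; last first.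
    exact: (measurableT_comp mk (pair2_measurable x)).
  (* For fixed x, symmetry of [dot] makes F(x) the fixed vector of [integral_dot]; the integral over
     w becomes that of [nlog] of a product, which splits. *)
  rewrite /k /=; under eq_integral do rewrite dotC.
  have mnM : measurable_fun setT (fun t : R => nlog (t / M)).
    by apply: (measurableT_comp (@measurable_nlog R)); exact: measurable_funM.
  rewrite (integral_dot sigma_inv (g := fun t => nlog (t / M)))//; last first.
    by move=> t; exact: nlog_ge0.
  have a0 : 0 <= norm2 (eval_lift F (toC2 x)) / M.
    by rewrite divr_ge0 ?norm2_ge0// ltW.
  have a1 : norm2 (eval_lift F (toC2 x)) / M <= 1.
    by rewrite ler_pdivrMr// mul1r FM.
  transitivity (\int[sigma]_(w in D) (nlog (norm2 (eval_lift F (toC2 x)) / M) +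
      nlog (modulus (toC2 w).1)))%E.
    apply: eq_integral => w; rewrite inE => Dw.
    by rewrite mulrAC (nlogM a0 a1 (modulus_ge0 _) (sphere_modulus1 Dw)).
  have mn := measurableT_comp (@measurable_nlog R) (@measurable_modulus_coord R).1.
  rewrite ge0_integralD//.
  - rewrite integral_nlog_coord//; congr (_ + _)%E.
    exact: integral_cst_sphere.
  - by move=> w _; exact: nlog_ge0.
  - by move=> w _; exact: nlog_ge0.
  - exact: measurable_funTS.
rewrite ge0_integralD//.
- by rewrite intF integral_cst_sphere.
- by move=> x _; exact: nlog_ge0.
- apply: measurable_funTS; apply: (measurableT_comp (@measurable_nlog R)).
  by apply: measurable_funM => //; exact: measurable_norm2_lift.
- move=> x _; rewrite -integral_nlog_coord//; apply: integral_ge0 => y _.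
  exact: nlog_ge0.
Qed.

End Averaging.

(** * Fine partitions of the sphere and oscillation of the regularized kernel *)

Section Equidistribution.
Variable R : realType.
Local Notation T := (4.-tuple R).
Variable sigma : probability T R.
Hypothesis sigma_inv : rotation_invariant_on_S3 sigma.
Local Notation D := (@sphere R).
Let mD := @measurable_sphere R.

(** If f exceeded q / p + eps throughout A, with p the measure of A, its integral would be at least
    q + eps p > q. The slack eps makes this strict, and the point found has a finite value. *)
Lemma exists_le_mean (A : set T) (f : T -> \bar R) (q eps : R) :
  measurable A -> measurable_fun setT f -> (forall x, (0 <= f x)%E) ->
  0 < fine (sigma A) -> 0 < eps -> (\int[sigma]_(x in A) f x <= q%:E)%E ->
  exists a, exists r, [/\ A a, f a = r%:E &
    r * fine (sigma A) <= q + eps * fine (sigma A)].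
Proof.
move=> mA mf f0 p0 eps0 intq; set p := fine _ in p0 *.
have sA : (sigma A = p%:E)%E by rewrite fineK// fin_num_measure.
pose c := q / p + eps.
have [[a [Aa fc]]|] := pselect (exists a, A a /\ (f a <= c%:E)%E).
  have [r fr] : exists r, f a = r%:E.
    exists (fine (f a)); rewrite fineK// ge0_fin_numE//.
    by rewrite (le_lt_trans fc)// ltry.
  exists a, r; split => //; move: fc; rewrite fr lee_fin /c => rc.
  rewrite -ler_pdivlMr// mulrDl -mulrA divff ?gt_eqF// mulr1.
  by [].
move=> /forallNP fc; exfalso.
(* The constant is truncated at 0 to compare nonnegative integrands; f stays above it, being
   nonnegative. *)
have : (\int[sigma]_(x in A) (cst (Num.max 0 c)%:E) x <= q%:E)%E.
  apply: le_trans intq; apply: ge0_le_integral => //.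
  - by move=> x _ /=; rewrite lee_fin le_max lexx.
  - exact: measurable_funTS.
  - move=> x Ax /=; rewrite EFin_max ge_max f0/= leNgt.
    by apply/negP => /ltW h; apply: (fc x).
rewrite integral_cst// => h.
have : ((Num.max 0 c)%:E * p%:E <= q%:E)%E by rewrite -sA.
rewrite -EFinM lee_fin => {}h.
have : c * p <= q.
  apply: le_trans h; apply: ler_wpM2r; first exact: ltW.
  by rewrite le_max lexx orbT.
rewrite /c mulrDl divfK ?gt_eqF// gerDl.
by rewrite leNgt mulr_gt0.
Qed.

Lemma sphere_coord (x : T) (j : 'I_4) : D x -> `|tnth x j| <= 1.
Proof.
move=> /sphere_norm x1; have := sqr_norm2 (toC2 x).
rewrite x1 expr1n !sqr_modulus /= => e.
rewrite -(@ler_pXn2r _ 2)// ?nnegrE// expr1n real_normK ?num_real//.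
have s k := sqr_ge0 (tnth x k).
have := s i4_0; have := s i4_1; have := s i4_2; have := s i4_3.
rewrite e; case: j => -[|[|[|[|//]]]] h; rewrite (bool_irrelevance h (erefl true));
  by move: e; lra.
Qed.

Lemma sphere_partition (eta : R) : 0 < eta ->
  exists (I : finType) (A : I -> set T), [/\ (forall i, measurable (A i)),
    trivIset setT A, D = \big[setU/set0]_i A i &
    forall i x y, A i x -> A i y -> forall j, `|tnth x j - tnth y j| <= eta].
Proof.
move=> eta0.
have [n n0 n_eta] : exists2 n : nat, 0 < n%:R :> R & n%:R^-1 <= eta.
  exists (Num.bound eta^-1).+1; first by rewrite ltr0n.
  rewrite -[leRHS]invrK lef_pV2 ?posrE ?invr_gt0//.
  apply: ltW; apply: (lt_trans (archi_boundP _)); first by rewrite invr_ge0 ltW.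
  by rewrite ltr_nat.
(* Cells are grid cubes of side 1/n cut with the sphere. On [-1, 1] the floor of n (x_j + 1) takes
   the values 0 to 2n, the last one at x_j = 1. *)
pose I := {ffun 'I_4 -> 'I_(2 * n).+1}.
pose cell (i : I) (j : 'I_4) : set T :=
  [set x | ((i j)%:R <= n%:R * (tnth x j + 1) < (i j).+1%:R)%R].
pose A (i : I) := D `&` \bigcap_(j in setT) cell i j.
exists I, A; split.
- move=> i; apply: measurableI => //; apply: fin_bigcap_measurable => [|j _].
    exact: finite_finset.
  have mf : measurable_fun setT (fun x : T => n%:R * (tnth x j + 1)).
    apply: measurable_funM => //; apply: measurable_funD => //.
    exact: measurable_coord.
  have := mf measurableT _ (measurable_itv `[(i j)%:R, (i j).+1%:R[).
  by rewrite setTI; congr measurable; apply/seteqP; split => x /=; rewrite in_itv.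
- apply/trivIsetP => i k _ _; apply: contraNeq => /set0P[x [[_ xi] [_ xk]]].
  apply/eqP/ffunP => j; apply/val_inj.
  have /andP[h1 h2] := xi j Logic.I; have /andP[h3 h4] := xk j Logic.I.
  have := le_lt_trans h1 h4; have := le_lt_trans h3 h2.
  by rewrite !ltr_nat !ltnS => h5 h6; apply/eqP; rewrite eqn_leq h5 h6.
- apply/seteqP; split => [x Dx|x].
  + have y0 j : 0 <= n%:R * (tnth x j + 1).
      have := sphere_coord j Dx; rewrite ler_norml => /andP[h _].
      by rewrite mulr_ge0// -lerBlDr sub0r.
    have y2 j : (Num.truncn (n%:R * (tnth x j + 1)) < (2 * n).+1)%N.
      rewrite ltnS -(ler_nat R) (@le_trans _ _ (n%:R * (tnth x j + 1)))// ?truncn_le//.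
      have := sphere_coord j Dx; rewrite ler_norml => /andP[_ h].
      by rewrite natrM mulrC ler_wpM2r ?(ltW n0)//; lra.
    pose i : I := [ffun j => Ordinal (y2 j)].
    rewrite -bigcup_seq; exists i; first by rewrite /= mem_index_enum.
    split => // j _; rewrite /cell /= ffunE /=.
    exact: truncn_itv.
  + by rewrite -bigcup_seq => -[i _ []].
- move=> i x y [_ xi] [_ yi] j.
  have /andP[h1 h2] := xi j Logic.I; have /andP[h3 h4] := yi j Logic.I.
  apply: le_trans n_eta; rewrite -[leRHS]mul1r ler_pdivlMr//.
  rewrite -[X in _ * X]gtr0_norm// -normrM ler_norml.
  move: h2 h4; rewrite -!natr1 => h2 h4.
  by apply/andP; split; lra.
Qed.

(** The constant 4 counts the real coordinates, as both entries of u have modulus at most 1. *)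
Lemma modulus_dot_lipschitz (u : C2 R) (x y : T) (eta : R) : norm2 u = 1 ->
  (forall j, `|tnth x j - tnth y j| <= eta) ->
  modulus (dot u (toC2 x)) <= modulus (dot u (toC2 y)) + 4 * eta.
Proof.
move=> u1 xy.
have e : dot u (toC2 x) = dot u (toC2 y) +
   (u.1 * ((toC2 x).1 - (toC2 y).1) + u.2 * ((toC2 x).2 - (toC2 y).2)).
  by rewrite /dot; ring.
rewrite e (le_trans (modulusD _ _))// lerD2l (le_trans (modulusD _ _))//.
rewrite !modulusM.
have h1 : modulus ((toC2 x).1 - (toC2 y).1) <= 2 * eta.
  rewrite (le_trans (modulus_le _))//=.
  by have := xy i4_0; have := xy i4_1; lra.
have h2 : modulus ((toC2 x).2 - (toC2 y).2) <= 2 * eta.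
  rewrite (le_trans (modulus_le _))//=.
  by have := xy i4_2; have := xy i4_3; lra.
have u11 := modulus1_le_norm2 u; have u21 := modulus2_le_norm2 u.
rewrite u1 in u11 u21.
have H (b c : R) : b <= 1 -> 0 <= c -> b * c <= c by move=> *; rewrite ler_piMl.
have := H _ _ u11 (modulus_ge0 ((toC2 x).1 - (toC2 y).1)).
have := H _ _ u21 (modulus_ge0 ((toC2 x).2 - (toC2 y).2)).
by lra.
Qed.

(** Here s + d <= (t + d) (1 + w / (t + d)), and ln (1 + x) <= x with t + d >= d. *)
Lemma ln_lipschitz (d s t : R) : 0 < d -> 0 <= s -> 0 <= t ->
  forall w, s <= t + w -> 0 <= w -> ln (s + d) <= ln (t + d) + w / d.
Proof.
move=> d0 s0 t0 w st w0.
have td : 0 < t + d by rewrite ltr_wpDl.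
have wd : 0 <= w / (t + d) by rewrite divr_ge0// ltW.
have w1 : 0 < 1 + w / (t + d) by rewrite ltr_wpDr.
apply: (@le_trans _ _ (ln ((t + d) * (1 + w / (t + d))))).
  rewrite ler_ln ?posrE; [|exact: ltr_wpDl|exact: mulr_gt0].
  by rewrite mulrDr mulr1 mulrCA divff ?gt_eqF// mulr1; lra.
rewrite lnM ?posrE//.
rewrite lerD2l (@le_trans _ _ (w / (t + d)))//.
  by apply: le_ln1Dx; rewrite (lt_le_trans _ wd)// ltrN10.
by rewrite ler_wpM2l// lef_pV2 ?posrE// lerDr.
Qed.

End Equidistribution.

Section Points.
Variable R : realType.
Local Notation T := (4.-tuple R).
Variable sigma : probability T R.
Hypothesis sigma_inv : rotation_invariant_on_S3 sigma.
Local Notation D := (@sphere R).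
Let mD := @measurable_sphere R.
Let J := nlog_coord sigma.

Variable pot : T -> \bar R.
Variable Q eps : R.
Hypothesis mpot : measurable_fun setT pot.
Hypothesis pot0 : forall x, (0 <= pot x)%E.
Hypothesis intpot : (\int[sigma]_(x in D) pot x = Q%:E)%E.
Hypothesis eps0 : 0 < eps.

(* Weighted points that are nearly equidistributed for the kernel log |u . w|,
   from above and uniformly in u, and whose mean potential is nearly at most the
   integral: in each cell of a fine partition of the sphere, a point is chosen
   where the potential does not exceed its mean. *)
Lemma exists_points :
  exists (I : finType) (p r : I -> R) (a : I -> T) (d : R),
  [/\ 0 < d <= 1, (forall i, 0 <= p i) /\ \sum_i p i = 1,
     (forall i, D (a i) /\ pot (a i) = (r i)%:E),
     \sum_i p i * r i <= Q + eps &
     forall u, norm2 u = 1 ->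
       \sum_i p i * ln (modulus (dot u (toC2 (a i))) + d) <= - J + eps].
Proof.
have [d /andP[d0 d1] intd] : exists2 d : R, 0 < d <= 1 &
  ((ln 2 + nlog_coord sigma - eps / 2)%:E <=
   \int[sigma]_(x in D) reglog d (modulus (toC2 x).1))%E.
  by apply: integral_reglog_coord => //; rewrite divr_gt0.
(* Within a cell |u . x| varies by at most 4 eta, hence ln (|u . x| + d) by at most 4 eta / d = eps
   / 2. The other eps / 2 is spent on the regularization. *)
pose eta := eps * d / 8.
have eta0 : 0 < eta by rewrite divr_gt0// mulr_gt0.
have [I [A [mA tA DA etaA]]] := sphere_partition eta0.
have AD i : A i `<=` D.
  by rewrite DA -bigcup_seq => x Ax; exists i => //=; rewrite mem_index_enum.
pose p i := fine (sigma (A i)).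
have sA i : sigma (A i) = (p i)%:E by rewrite fineK// fin_num_measure.
have cstA i (c : R) : (\int[sigma]_(x in A i) c%:E = (c * p i)%:E)%E.
  by rewrite integral_cst// EFinM; congr (_ * _)%E; exact: sA.
have p0 i : 0 <= p i by apply: fine_ge0.
have sumA (f : T -> \bar R) : measurable_fun setT f -> (forall x, (0 <= f x)%E) ->
    (\int[sigma]_(x in D) f x = \sum_i \int[sigma]_(x in A i) f x)%E.
  move=> mf f0; rewrite [in LHS]DA ge0_integral_bigsetU//.
  - exact: index_enum_uniq.
  - by apply: sub_trivIset tA.
  - exact: measurable_funTS.
have q0 i : (0 <= \int[sigma]_(x in A i) pot x)%E by apply: integral_ge0.
pose q i := fine (\int[sigma]_(x in A i) pot x)%E.
have qE i : (\int[sigma]_(x in A i) pot x = (q i)%:E)%E.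
  rewrite fineK// ge0_fin_numE//; apply: (@le_lt_trans _ _ Q%:E); last by rewrite ltry.
  rewrite -intpot; apply: ge0_subset_integral => //; first exact: measurable_funTS.
have sump : \sum_i p i = 1.
  apply: EFin_inj; rewrite -sumEFin -(integral_cst_sphere sigma_inv 1%E).
  rewrite sumA//; apply: eq_bigr => i _.
  by rewrite cstA mul1r.
have sumq : \sum_i q i = Q.
  apply: EFin_inj; rewrite -sumEFin -intpot sumA//.
  by apply: eq_bigr => i _; rewrite qE.
have qle i : (\int[sigma]_(x in A i) pot x <= (q i)%:E)%E by rewrite qE.
have Qle : (\int[sigma]_(x in D) pot x <= Q%:E)%E by rewrite intpot.
have ex_point i : exists ar : T * R, [/\ D ar.1, pot ar.1 = ar.2%:E,
    p i * ar.2 <= q i + eps * p i & 0 < p i -> A i ar.1].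
  have [pi0|] := ltP 0 (p i).
    have [a [r [Aa pa h]]] := exists_le_mean (mA i) mpot pot0 pi0 eps0 (qle i).
    by exists (a, r); split => //=; [exact: AD Aa|rewrite mulrC].
  (* A null cell may be empty. Its weight is 0, so any point of the sphere with finite potential
     will do. *)
  move=> pi0; have {}pi0 : p i = 0 by apply/eqP; rewrite eq_le pi0 p0.
  have D1 : 0 < fine (sigma D) by rewrite (sigma_sphere sigma_inv).
  have [a [r [Da pa _]]] := exists_le_mean mD mpot pot0 D1 eps0 Qle.
  exists (a, r); split => //=; rewrite pi0 ?ltxx// mul0r mulr0 addr0.
  by apply: fine_ge0.
have [ar arP] := fin_all_exists ex_point.
exists I, p, (fun i => (ar i).2), (fun i => (ar i).1), d; split => //.
- by rewrite d0 d1.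
- by move=> i; have [] := arP i.
- rewrite -sumq -[X in _ <= _ + X]mulr1 -sump mulr_sumr -big_split /=.
  by apply: ler_sum => i _; have [] := arP i.
move=> u u1; pose t i := modulus (dot u (toC2 (ar i).1)).
have t0 i : 0 <= t i by exact: modulus_ge0.
have t1 i : t i <= 1.
  rewrite (le_trans (modulus_dot _ _))// u1 mul1r sphere_norm//.
  by have [] := arP i.
pose g (x : T) := reglog d (modulus (dot u (toC2 x))).
have g0 x : (0 <= g x)%E by exact: reglog_ge0.
have mg : measurable_fun setT g.
  by apply: (measurableT_comp (measurable_reglog d)); exact: measurable_dot.
have gE x : D x -> g x = (ln 2 - ln (modulus (dot u (toC2 x)) + d))%:E.
  move=> Dx; have := modulus_dot u (toC2 x); rewrite u1 mul1r sphere_norm// => h.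
  by rewrite /g reglogE ?modulus_ge0//; lra.
have gA i : (\int[sigma]_(x in A i) g x <=
    (p i * (ln 2 - ln (t i + d) + eps / 2))%:E)%E.
  (* The point attached to a null cell need not lie in it, so only the trivial majorant ln 2 - ln d
     is available there; it is multiplied by [p i] = 0. *)
  pose c : R := if 0 < p i then ln 2 - ln (t i + d) + eps / 2 else ln 2 - ln d.
  apply: (@le_trans _ _ (c * p i)%:E); last first.
    rewrite lee_fin /c; case: ltP => [_|pi0]; first by rewrite mulrC.
    have -> : p i = 0 by apply/eqP; rewrite eq_le pi0 p0.
    by rewrite mul0r mulr0.
  have gc x : A i x -> (g x <= c%:E)%E.
    move=> Ax; rewrite gE; last exact: AD Ax.
    rewrite lee_fin /c; case: ltP => pi0.
      have [_ _ _ /(_ pi0) Aa] := arP i.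
      have := modulus_dot_lipschitz u1 (etaA i _ _ Aa Ax).
      rewrite -/(t i) => /(ln_lipschitz d0 (t0 i) (modulus_ge0 _)).
      rewrite mulr_ge0 ?(ltW eta0)// => /(_ isT).
      have -> : 4 * eta / d = eps / 2 by rewrite /eta; field; rewrite gt_eqF.
      by lra.
    rewrite lerD2l lerN2 ler_ln ?posrE//; last by rewrite ltr_wpDl// modulus_ge0.
    by rewrite lerDr modulus_ge0.
  have c0 x : A i x -> 0 <= c.
    by move=> /gc h; rewrite -lee_fin (le_trans _ h).
  rewrite -cstA.
  apply: ge0_le_integral => //.
  - exact: measurable_funTS.
(* Summed over the cells: ln 2 + J - eps/2 is at most the integral of g, which is at most ln 2 +
   eps/2 minus the weighted sum to be bounded. *)
have := intd.
rewrite -[X in (_ <= X)%E](_ : (\int[sigma]_(x in D) g x)%E = _); last first.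
  rewrite /g (integral_dot sigma_inv u (measurable_reglog d)); last exact: reglog_ge0.
  by rewrite u1; under eq_integral do rewrite mul1r.
rewrite sumA// => /le_trans.
have := lee_sum (index_enum I) (fun i _ => gA i) => gS.
move=> /(_ _ (lee_sum _ (fun i _ => gA i))); rewrite sumEFin lee_fin.
have -> : \sum_i p i * (ln 2 - ln (t i + d) + eps / 2) =
    (ln 2 + eps / 2) * \sum_i p i - \sum_i p i * ln (t i + d).
  rewrite mulr_sumr -sumrB; apply: eq_bigr => i _; ring.
by rewrite sump /J; lra.
Qed.

End Points.

(** * Capacity *)

Section Capacity.
Variable R : realType.
Local Notation T := (4.-tuple R).
Variable sigma : probability T R.
Hypothesis sigma_inv : rotation_invariant_on_S3 sigma.
Local Notation D := (@sphere R).
Let mD := @measurable_sphere R.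
Let J := nlog_coord sigma.

Variables (F : polyXY R * polyXY R) (d : nat) (c s : R).
Hypothesis d0 : (0 < d)%N.
Hypothesis F1hom : homogeneous d F.1.
Hypothesis F2hom : homogeneous d F.2.
Hypothesis c0 : 0 < c.
Hypothesis Fc : forall z, norm2 z = 1 -> c <= norm2 (eval_lift F z).
Hypothesis Fs : log_integral sigma (fun x => norm2 (eval_lift F (toC2 x))) s.

Let E : set (C2 R) := eval_lift F @^-1` S3.
Let d0' : 0 < d%:R :> R. Proof. by rewrite ltr0n. Qed.

Lemma eval_lift_scale (t : R[i]) z :
  norm2 (eval_lift F (t * z.1, t * z.2)) = modulus t ^+ d * norm2 (eval_lift F z).
Proof.
by rewrite /eval_lift (evalXY_scale _ _ F1hom) (evalXY_scale _ _ F2hom)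
  -modulusX -norm2_scale.
Qed.

Lemma eval_lift_ge z : c * norm2 z ^+ d <= norm2 (eval_lift F z).
Proof.
have [z0|z0] := eqVneq (norm2 z) 0.
  by rewrite z0 expr0n gtn_eqF// mulr0 norm2_ge0.
have n0 : 0 < norm2 z by rewrite lt_neqAle eq_sym z0 norm2_ge0.
have h : norm2 (((norm2 z)^-1)%:C%C * z.1, ((norm2 z)^-1)%:C%C * z.2) = 1.
  by rewrite norm2_scale modulus_real ger0_norm ?invr_ge0 ?norm2_ge0// mulVf.
have := Fc h; rewrite eval_lift_scale modulus_real ger0_norm ?invr_ge0 ?norm2_ge0//.
by rewrite exprVn ler_pdivlMl ?exprn_gt0// mulrC.
Qed.

Let rho := Num.max 1 c^-1.

(** If |z| > 1, then c |z| <= c |z|^d <= 1. Boundedness of E makes [sup_norm] a genuine supremum. *)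
Lemma preimage_sphere_bounded z : E z -> norm2 z <= rho.
Proof.
move=> Ez; rewrite /rho le_max; have [//|z1] := leP (norm2 z) 1.
have := eval_lift_ge z; rewrite (_ : norm2 (eval_lift F z) = 1)//.
rewrite -ler_pdivlMl// mulr1; apply: le_trans.
by rewrite -[leLHS]expr1 ler_weXn2l// ltW.
Qed.

Lemma sup_norm_ge (Q : polyXY R) z : E z ->
  modulus (evalXY Q z) <= sup_norm E (evalXY Q).
Proof.
move=> Ez; have [B QB] := evalXY_bounded Q rho.
apply: ub_le_sup; last by exists z.
by exists B => _ [w Ew <-]; apply: QB; exact: preimage_sphere_bounded.
Qed.

(** This is ||F(v)||^(-1/d), the positive factor that carries a unit vector v onto E. *)
Let radius v := expR (- (ln (norm2 (eval_lift F v)) / d%:R)).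

Lemma preimage_sphere_scale v : norm2 v = 1 ->
  E ((radius v)%:C%C * v.1, (radius v)%:C%C * v.2).
Proof.
move=> v1; have n0 : 0 < norm2 (eval_lift F v) by apply: (lt_le_trans c0); exact: Fc.
rewrite /E /= /S3 /= eval_lift_scale modulus_real gtr0_norm ?expR_gt0//.
rewrite -expRM_natl mulrN mulrCA divff ?gt_eqF// mulr1 expRN lnK ?posrE//.
by rewrite mulVf ?gt_eqF.
Qed.

Lemma preimage_sphere_nonempty : E !=set0.
Proof.
have h : norm2 ((1, 0) : C2 R) = 1.
  by rewrite /norm2 /= modulus1 modulus0 expr1n expr0n addr0 sqrtr1.
by eexists; exact: preimage_sphere_scale h.
Qed.

(** Q is evaluated at the multiple of v lying on E, and the scaling is undone by homogeneity. *)
Lemma sup_norm_homogeneous_ge (Q : polyXY R) k v : homogeneous k Q ->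
  norm2 v = 1 -> modulus (evalXY Q v) <=
  sup_norm E (evalXY Q) * expR (k%:R / d%:R * ln (norm2 (eval_lift F v))).
Proof.
move=> Qhom v1; have := sup_norm_ge Q (preimage_sphere_scale v1).
rewrite (evalXY_scale _ _ Qhom) modulusM modulusX modulus_real gtr0_norm ?expR_gt0//.
rewrite -expRM_natl => h.
rewrite -ler_pdivrMr ?expR_gt0// -expRN mulrC.
by apply: le_trans h; rewrite ler_wpM2r ?modulus_ge0// ler_expR; lra.
Qed.

Lemma int_log_coord : int_log sigma (fun z => modulus z.1) = (- J)%:E.
Proof. exact: (log_integral_coord sigma_inv).2. Qed.

Lemma normalized_sup_norm_ge (Q : polyXY R) k : normalized sigma k Q ->
  expR (k%:R * (- J - s / d%:R)) <= sup_norm E (evalXY Q).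
Proof.
move=> [Qhom]; rewrite int_log_coord -EFinM => intQ.
(* [ln] of a vanishing supremum would be a default value, so the estimate is proved for every
   positive w above the supremum. *)
have key w : 0 < w -> sup_norm E (evalXY Q) <= w ->
    expR (k%:R * (- J - s / d%:R)) <= w.
  move=> w0 supw; rewrite -[leRHS]lnK ?posrE// ler_expR.
  suff : k%:R * - J <= ln w + k%:R / d%:R * s by lra.
  rewrite -lee_fin -intQ.
  have iw : sigma.-integrable D (cst (ln w)%:E).
    by apply: finite_measure_integrable_cst.
  have iF := integrableZl mD (k%:R / d%:R) Fs.1.
  have -> : ((ln w + k%:R / d%:R * s)%:E = \int[sigma]_(x in D)
      ((ln w)%:E + (k%:R / d%:R)%:E * lne (norm2 (eval_lift F (toC2 x)))%:E))%E.
    rewrite (integralD mD iw iF).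
    by rewrite integral_cst_sphere// integralZl//; [rewrite Fs.2|exact: Fs.1].
  apply: (le_integral_sphere sigma).
  - exact: (measurableT_comp (@measurable_lne R) (measurable_modulus_evalXY Q)).
  - apply: emeasurable_funD => //; apply: measurable_funeM.
    exact: (measurableT_comp (@measurable_lne R) (measurable_norm2_lift F)).
  move=> x Dx; have := sup_norm_homogeneous_ge Qhom (sphere_norm Dx).
  set n := norm2 (eval_lift F (toC2 x)) => h.
  have n0 : 0 < n by apply: (lt_le_trans c0); exact: Fc.
  rewrite (lne_EFin n0) -EFinM -EFinD.
  have [m0|m0] := leP (modulus (evalXY Q (toC2 x))) 0.
    by rewrite le0_lneNy ?leNye// lee_fin.
  rewrite lne_EFin// lee_fin -[X in _ <= _ + X]expRK -lnM ?posrE ?expR_gt0//.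
  rewrite ler_ln ?posrE ?mulr_gt0 ?expR_gt0// (le_trans h)//.
  by rewrite ler_wpM2r// expR_ge0.
(* If the supremum were below x, the larger of it and x / 2 would be positive and still below x. *)
rewrite leNgt; apply/negP => h; set x := expR _ in h key.
have x0 : 0 < x by exact: expR_gt0.
have := key (Num.max (sup_norm E (evalXY Q)) (x / 2)).
rewrite lt_max divr_gt0 ?orbT// le_max lexx => /(_ isT isT).
by rewrite le_max leNgt h /= ler_pdivlMr//; lra.
Qed.

Lemma evalXY_dot (w z : C2 R) :
  evalXY (w.1 *: F.1 + w.2 *: F.2) z = dot w (eval_lift F z).
Proof. by rewrite evalXYD !evalXYZ. Qed.

Lemma homogeneous_dot (w : C2 R) : homogeneous d (w.1 *: F.1 + w.2 *: F.2).
Proof. by apply: dhomogD; apply: dhomogZ. Qed.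

Lemma homogeneous_prod (I : finType) (P : I -> polyXY R) (n : I -> nat) (m : nat) :
  (forall i, homogeneous m (P i)) ->
  homogeneous (m * \sum_i n i) (\prod_i P i ^+ n i).
Proof.
move=> hP; elim/big_ind2: _ => [|a p b q|i _].
- by rewrite muln0; exact: dhomog1.
- by move=> hp hq; rewrite mulnDr; exact: dhomogM.
- by apply: dhomogMn; exact: hP.
Qed.

(* The polynomial prod (a_i . F)^(n_i) X^(k - d sum n_i), n_i = [k p_i / d], is
   within a bounded factor of optimal when the a_i, weighted by the p_i, are
   equidistributed on the sphere. *)
Lemma exists_good_polynomials (eps : R) : 0 < eps -> exists B : R, forall k,
  exists2 Q, normalized sigma k Q &
    sup_norm E (evalXY Q) <= expR (k%:R * (- J - s / d%:R + eps) + B).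
Proof.
move=> eps0.
have [B0 FB0] := lift_bounded_above F.
have FcB x : D x -> c <= norm2 (eval_lift F (toC2 x)) <= B0.
  by move=> Dx; rewrite FB0 ?Fc// sphere_norm.
have [M [N [M0 FM intF liF]]] :=
  log_integral_bounded sigma_inv (measurable_norm2_lift F) c0 FcB.
have sE : s = ln M - N by apply: EFin_inj; rewrite -Fs.2 -liF.2.
have [I [p [r [a [dl [/andP[dl0 dl1] [p0 sump] aP pr pf]]]]]] :=
  exists_points sigma_inv (measurable_potential sigma_inv F M)
    (potential_ge0 sigma F M) (integral_potential sigma_inv M0 FM intF)
    (divr_gt0 eps0 (ltr0n R 2)).
rewrite -/J in pr pf.
have aE i : norm2 (toC2 (a i)) = 1 by apply: sphere_norm; have [] := aP i.
pose P i := (toC2 (a i)).1 *: F.1 + (toC2 (a i)).2 *: F.2.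
have liP i : log_integral sigma (fun x => modulus (evalXY (P i) (toC2 x))) (ln M - r i).
  apply: log_integral_nlog => //; first exact: measurable_modulus_evalXY.
    move=> x Dx; rewrite modulus_ge0/= evalXY_dot (le_trans (modulus_dot _ _))//.
    by rewrite aE mul1r FM.
  by have [_ <-] := aP i; apply: eq_integral => x _; rewrite evalXY_dot.
have J0 : 0 <= J by apply: fine_ge0; apply: integral_ge0 => x _; exact: nlog_ge0.
have rho1 : 1 <= rho by rewrite /rho le_max lexx.
(* The first sum pays for rounding the exponents [m i] down to [n i]. The second pays for the at
   most d #|I| factors X, each costing J in the normalization and ln rho on E. *)
exists (\sum_i (`|ln M - r i| - ln dl) + (d * #|I|)%:R * (J + ln rho)) => k.
pose m i : R := k%:R * p i / d%:R.
have m0 i : 0 <= m i by rewrite divr_ge0// mulr_ge0.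
pose n i := Num.truncn (m i).
have nm i : (n i)%:R <= m i by rewrite truncn_le.
have mn i : m i < (n i)%:R + 1.
  by have /andP[_] := truncn_itv (m0 i); rewrite -natr1.
have summ : \sum_i m i = k%:R / d%:R.
  by rewrite -mulr_suml -mulr_sumr sump mulr1.
have sumn : (d * \sum_i n i <= k)%N.
  rewrite -(ler_nat R) natrM -ler_pdivlMl// mulrC -summ natr_sum.
  by apply: ler_sum.
pose q := (k - d * \sum_i n i)%N.
have kq : (d * \sum_i n i + q)%N = k by rewrite subnKC.
have qle : (q <= d * #|I|)%N.
  rewrite leq_subLR -mulnDr -(ler_nat R) natrM -ler_pdivrMl// mulrC -summ natrD.
  rewrite natr_sum -sum1_card natr_sum -big_split /=.
  by apply: ler_sum => i _; exact: ltW.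
pose Q0 := \prod_i P i ^+ n i * mpolyX R[i] (mnm1 ord0) ^+ q.
have Q0E z : modulus (evalXY Q0 z) =
    (\prod_i modulus (evalXY (P i) z) ^+ n i) * modulus z.1 ^+ q.
  rewrite /Q0 evalXYM evalXY_prod modulusM modulus_prod evalXYX evalXY_X modulusX.
  by congr (_ * _); apply: eq_bigr => i _; rewrite evalXYX modulusX.
have Q0hom : homogeneous k Q0.
  rewrite -kq; apply: dhomogM.
    by apply: homogeneous_prod => i; exact: homogeneous_dot.
  have hX : homogeneous 1 (mpolyX R[i] (mnm1 (ord0 : 'I_2))).
    by rewrite /homogeneous dhomogX /= mdeg1.
  by have := dhomogMn q hX; rewrite mul1n.
pose S := \sum_i (n i)%:R * (ln M - r i) + q%:R * - J.
have liQ0 : log_integral sigma (fun x => modulus (evalXY Q0 (toC2 x))) S.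
  under eq_fun do rewrite Q0E.
  apply: log_integralM => //.
  - by move=> x; apply: prodr_ge0 => i _; rewrite exprn_ge0// modulus_ge0.
  - by move=> x; rewrite exprn_ge0// modulus_ge0.
  - apply: log_integral_prod => // [i x|i]; first by rewrite exprn_ge0// modulus_ge0.
    by apply: log_integralX => // x; exact: modulus_ge0.
  - apply: log_integralX => //; first by move=> x; exact: modulus_ge0.
    exact: log_integral_coord.
(* The scalar that moves the logarithmic integral from S to the required - k J. *)
pose C := expR (k%:R * - J - S).
have C0 : 0 < C by exact: expR_gt0.
pose Q := C%:C%C *: Q0.
have QE z : modulus (evalXY Q z) = C * modulus (evalXY Q0 z).
  by rewrite evalXYZ modulusM modulus_real gtr0_norm.
exists Q.
  split; first exact: dhomogZ.
  rewrite int_log_coord -EFinM -[X in _ = X](_ : (ln C + S)%:E = _); last first.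
    by rewrite expRK subrK.
  rewrite /int_log; under eq_fun do rewrite QE.
  by apply: (log_integralM _ _ (log_integral_cst sigma_inv C0) liQ0).2 => x;
    rewrite ?modulus_ge0// ltW.
apply: ge_sup.
  by have [z Ez] := preimage_sphere_nonempty; exists (modulus (evalXY Q z)), z.
move=> _ [z Ez <-]; rewrite QE Q0E.
(* On E the vector F(z) has norm 1, so the bound [pf], uniform over unit vectors, applies to it. *)
have u1 : norm2 (eval_lift F z) = 1 by [].
pose t i := modulus (dot (eval_lift F z) (toC2 (a i))).
have t0 i : 0 <= t i by exact: modulus_ge0.
have td0 i : 0 < t i + dl by rewrite ltr_wpDl.
have hf := pf _ u1.
have h1 : \prod_i modulus (evalXY (P i) z) ^+ n i <=
    expR (\sum_i (n i)%:R * ln (t i + dl)).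
  rewrite expR_sum; apply: ler_prod => i _.
  rewrite exprn_ge0 ?modulus_ge0//= expRM_natl lnK ?posrE//.
  rewrite lerXn2r ?nnegrE ?modulus_ge0 ?(ltW (td0 i))//.
  by rewrite evalXY_dot dotC lerDl ltW.
have h2 : modulus z.1 ^+ q <= expR (q%:R * ln rho).
  rewrite expRM_natl lnK ?posrE ?(lt_le_trans ltr01)//.
  rewrite lerXn2r ?nnegrE ?modulus_ge0 ?(le_trans ler01)//.
  by rewrite (le_trans (modulus1_le_norm2 z))// preimage_sphere_bounded.
apply: (@le_trans _ _ (C * (expR (\sum_i (n i)%:R * ln (t i + dl)) *
    expR (q%:R * ln rho)))).
  rewrite ler_wpM2l ?(ltW C0)// ler_pM// ?exprn_ge0 ?modulus_ge0//.
  by apply: prodr_ge0 => i _; rewrite exprn_ge0 ?modulus_ge0.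
rewrite /C -!expRD ler_expR /S.
have e1 : \sum_i m i * (ln M - r i) = k%:R / d%:R * (ln M - \sum_i p i * r i).
  have -> : ln M - \sum_i p i * r i = \sum_i p i * (ln M - r i).
    by under [RHS]eq_bigr do rewrite mulrBr; rewrite sumrB -mulr_suml sump mul1r.
  rewrite mulr_sumr.
  by apply: eq_bigr => i _; rewrite /m; ring.
have e2 : \sum_i m i * ln (t i + dl) = k%:R / d%:R * (\sum_i p i * ln (t i + dl)).
  by rewrite mulr_sumr; apply: eq_bigr => i _; rewrite /m; ring.
(* Each [m i] - [n i] lies in [0, 1[, and ln (t + dl) >= ln dl: because of the regularization the
   rounding error is bounded independently of z and k. *)
have b1 : \sum_i (n i)%:R * ln (t i + dl) - \sum_i (n i)%:R * (ln M - r i) <=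
    \sum_i m i * ln (t i + dl) - \sum_i m i * (ln M - r i) +
    \sum_i (`|ln M - r i| - ln dl).
  rewrite -!sumrB -big_split /=; apply: ler_sum => i _.
  have lnd : ln dl <= ln (t i + dl) by rewrite ler_ln ?posrE// lerDr.
  have lnd0 : ln dl <= 0 by rewrite ln_le0.
  have := ler_norm (ln M - r i); set w := ln M - r i; have w0 := normr_ge0 w.
  have := nm i; have := mn i; set e := ln (t i + dl) in lnd *.
  move=> h3 h4 h5.
  have h6 : 0 <= (m i - (n i)%:R) * (e - ln dl) by rewrite mulr_ge0// subr_ge0.
  have h7 : 0 <= (1 - (m i - (n i)%:R)) * - ln dl.
    by rewrite mulr_ge0 ?oppr_ge0// subr_ge0 lerBlDl ltW.
  have h8 : (m i - (n i)%:R) * w <= `|w|.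
    apply: (@le_trans _ _ ((m i - (n i)%:R) * `|w|)).
      by rewrite ler_wpM2l// subr_ge0.
    by rewrite ler_piMl// lerBlDl ltW.
  by lra.
have b2 : q%:R * (J + ln rho) <= (d * #|I|)%:R * (J + ln rho).
  by rewrite ler_wpM2r ?ler_nat// addr_ge0// ln_ge0.
(* J cancels here: the first sum is at most - J + eps/2, the second at most N + J + eps/2. *)
have b3 : k%:R / d%:R * (\sum_i p i * ln (t i + dl) + \sum_i p i * r i) <=
    k%:R / d%:R * (N + eps).
  by rewrite ler_wpM2l ?divr_ge0//; lra.
have b4 : k%:R / d%:R * eps <= k%:R * eps.
  rewrite -mulrA ler_wpM2l// ler_piMl ?(ltW eps0)// invf_le1//.
  by rewrite ler1n.
move: b1; rewrite e1 e2 sE.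
by lra.
Qed.

(** The k-th root turns the additive constant B of the upper bound into B / k. Convergence is
    proved, so [limn] is a genuine limit. *)
Lemma pcapE : pcap sigma E = expR (- J - s / d%:R).
Proof.
set L := - J - s / d%:R.
have [B1 h1] := exists_good_polynomials ltr01.
have nonempty k : exists Q, normalized sigma k Q.
  by have [Q] := h1 k; exists Q.
have lower k : expR (k%:R * L) <= cap_min sigma E k.
  apply: lb_le_inf.
    by have [Q hQ] := nonempty k; exists (sup_norm E (evalXY Q)); exists Q.
  by move=> _ [Q hQ <-]; exact: normalized_sup_norm_ge.
have upper eps : 0 < eps -> exists B : R, forall k,
    cap_min sigma E k <= expR (k%:R * (L + eps) + B).
  move=> /exists_good_polynomials[B hB]; exists B => k.
  have [Q hQ Qle] := hB k; apply: le_trans Qle; apply: ge_inf; last by exists Q.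
  by exists (expR (k%:R * L)) => _ [P hP <-]; exact: normalized_sup_norm_ge.
have expR_powR k (x : R) : (0 < k)%N -> expR x `^ k%:R^-1 = expR (x / k%:R).
  by move=> k0; rewrite /powR gt_eqF ?expR_gt0// expRK mulrC.
apply: cvg_lim => //; apply/cvgrPdist_le => e e0.
(* The choice makes expR (L + 2 eps) equal to expR L + e: one eps comes from the polynomials, the
   other absorbs B / k. *)
have [eps eps0 he] : exists2 eps : R, 0 < eps & expR (L + eps * 2) <= expR L + e.
  exists (ln (1 + e * expR (- L)) / 2).
    by rewrite divr_gt0// ln_gt0// ltrDl mulr_gt0 ?expR_gt0.
  rewrite divfK ?pnatr_eq0// expRD lnK; last first.
    by rewrite posrE addr_gt0// mulr_gt0// expR_gt0.
  by rewrite mulrDr mulr1 mulrCA -expRD subrr expR0 mulr1.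
have [B hB] := upper _ eps0.
near=> k.
have k0 : (0 < k)%N by near: k; exists 1%N.
have k0' : 0 < k%:R :> R by rewrite ltr0n.
have Bk : B / k%:R <= eps.
  rewrite ler_pdivrMr// mulrC -ler_pdivrMr//.
  by near: k; exact: nbhs_infty_ger.
have low : expR L <= cap_min sigma E k `^ k%:R^-1.
  have -> : expR L = expR (k%:R * L) `^ k%:R^-1.
    by rewrite expR_powR// mulrAC divff ?mul1r// gt_eqF.
  rewrite ge0_ler_powR ?nnegrE ?invr_ge0 ?expR_ge0//.
  by rewrite (le_trans _ (lower k))// expR_ge0.
have upp : cap_min sigma E k `^ k%:R^-1 <= expR L + e.
  apply: le_trans he.
  apply: (@le_trans _ _ (expR (k%:R * (L + eps) + B) `^ k%:R^-1)).
    rewrite ge0_ler_powR ?nnegrE ?invr_ge0 ?expR_ge0//.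
    by rewrite (le_trans _ (lower k))// expR_ge0.
  rewrite expR_powR// ler_expR mulrDl mulrAC divff ?mul1r ?gt_eqF//.
  by lra.
by rewrite ler_norml; apply/andP; split; lra.
Unshelve. all: by end_near. Qed.

End Capacity.

(** * Homogeneous lifts *)

Section Lifts.
Variable R : realType.
Implicit Types (Q : polyXY R) (F : polyXY R * polyXY R) (z : C2 R) (d : nat).

Lemma dehomogenizeE Q : dehomogenize Q =
  \sum_(m <- msupp Q) (mcoeff m Q)%:P * 'X^(m (ord0 : 'I_2)).
Proof.
rewrite /dehomogenize /mmap; apply: eq_bigr => m _; congr (_ * _).
by rewrite /mmap1 big_ord_recl big_ord1 /coords2 /= expr1n mulr1.
Qed.

Lemma horner_dehomogenize Q (x : R[i]) : (dehomogenize Q).[x] = evalXY Q (x, 1).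
Proof.
rewrite dehomogenizeE evalXY_sum horner_sum; apply: eq_bigr => m _.
by rewrite !hornerE /= expr1n mulr1.
Qed.

Lemma size_dehomogenize d Q : homogeneous d Q -> (size (dehomogenize Q) <= d.+1)%N.
Proof.
move=> hQ; apply/leq_sizeP => j dj; rewrite dehomogenizeE coef_sum big_seq.
apply: big1 => m /(homogeneous_exponents hQ) md; rewrite coefCM coefXn.
by rewrite gtn_eqF ?mulr0// (leq_ltn_trans _ dj)// -md leq_addr.
Qed.

(** Only the monomial X^d survives at y = 0, so the coefficient of degree d governs the point at
    infinity. *)
Lemma evalXY_x0 d Q (x : R[i]) : homogeneous d Q ->
  evalXY Q (x, 0) = x ^+ d * (dehomogenize Q)`_d.
Proof.
move=> hQ; rewrite dehomogenizeE evalXY_sum coef_sum mulr_sumr big_seq [RHS]big_seq.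
apply: eq_bigr => m /(homogeneous_exponents hQ) md /=.
rewrite coefCM coefXn; have -> : (d == m ord0) = (m X2 == 0)%N.
  by rewrite -md -{2}[m ord0]addn0 eqn_add2l.
rewrite expr0n; have [m2|m2] := eqVneq (m X2) 0%N.
  by rewrite -md m2 addn0 !mulr1 mulrC.
by rewrite !mulr0.
Qed.

(** Against a reduced fraction p / q, the dehomogenizations are g p and g q. Their degrees are at
    most d while p or q has degree d, so g is constant. *)
Lemma dehomogenize_lift (f : {fraction {poly R[i]}}) d F :
  (1 <= d)%N -> has_degree f d -> homogeneous_lift f d F ->
  coprimep (dehomogenize F.1) (dehomogenize F.2) /\
  maxn (size (dehomogenize F.1)).-1 (size (dehomogenize F.2)).-1 = d.
Proof.
move=> d1 [p [q [q0 pq fpq szpq]]] [h1 h2 _ fF].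
set P := dehomogenize F.1 in fF *; set Q := dehomogenize F.2 in fF *.
(* Division by 0 yields 0, so Q = 0 would force f = 0, hence p = 0 and q constant, against d >=
   1. *)
have Q0 : Q != 0.
  apply/eqP => Q0; move: fF; rewrite Q0 tofrac0 invr0 mulr0 fpq => /eqP.
  rewrite mulf_eq0 invr_eq0 !tofrac_eq0 (negbTE q0) orbF => /eqP p0.
  move: pq szpq; rewrite p0 coprime0p -size_poly_eq1 => /eqP ->.
  by rewrite size_poly0 /= => d0; rewrite -d0 in d1.
have cross : P * q = p * Q.
  apply/eqP; rewrite -tofrac_eq !tofracM -eqr_div ?tofrac_eq0//.
  by rewrite -fF fpq.
have /dvdpP[g Qg] : q %| Q.
  by rewrite -(Gauss_dvdpr _ (_ : coprimep q p)) 1?coprimep_sym// -cross dvdp_mull.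
have Pg : P = g * p.
  by apply: (mulIf q0); rewrite cross Qg; ring.
have g0 : g != 0 by apply: contraNneq Q0 => g0; rewrite Qg g0 mul0r.
have sP : (size P <= d.+1)%N by exact: size_dehomogenize.
have sQ : (size Q <= d.+1)%N by exact: size_dehomogenize.
have g1 : size g = 1%N.
  have sg : (0 < size g)%N by rewrite size_poly_gt0.
  have sq : (0 < size q)%N by rewrite size_poly_gt0.
  move: szpq; rewrite /maxn; case: ltnP => _ sz.
    move: sQ sz sg sq d1; rewrite Qg size_mul//.
    by move: (size g) (size q) => x y; lia.
  have p0 : p != 0 by apply/eqP => p0; move: d1; rewrite -sz p0 size_poly0.
  have sp : (0 < size p)%N by rewrite size_poly_gt0.
  move: sP sz sg sp d1; rewrite Pg size_mul//.
  by move: (size g) (size p) => x y; lia.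
have /size_poly1P[y y0 gy] : size g == 1%N by rewrite g1.
rewrite Pg Qg gy !mul_polyC coprimepZl// coprimepZr//.
by rewrite !size_scale.
Qed.

(** A zero (a, b) with b != 0 gives the common root a / b of coprime polynomials. A zero (a, 0) with
    a != 0 kills both coefficients of degree d, so both degrees fall below d. *)
Lemma lift_zero_free (f : {fraction {poly R[i]}}) d F z :
  (1 <= d)%N -> has_degree f d -> homogeneous_lift f d F ->
  norm2 (eval_lift F z) = 0 -> z = (0, 0).
Proof.
move=> d1 fd hF /norm2_eq0 [z1 z2]; have [h1 h2 _ _] := hF.
have [cop szd] := dehomogenize_lift d1 fd hF.
case: z z1 z2 => a b z1 z2.
have [b0|b0] := eqVneq b 0; last first.
  have E Q : homogeneous d Q -> evalXY Q (a, b) = 0 -> root (dehomogenize Q) (a / b).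
    move=> hQ; have := evalXY_scale b (a / b, 1) hQ.
    rewrite /= mulrC divfK// mulr1 => -> /eqP.
    by rewrite mulf_eq0 expf_eq0 (negbTE b0) andbF/= -horner_dehomogenize.
  have r1 := E _ h1 z1; have r2 := E _ h2 z2.
  by have := coprimep_root cop r1; rewrite -/(root _ _) r2.
rewrite b0 in z1 z2 *; congr (_, _); apply/eqP; apply: contraT => a0.
have E Q : homogeneous d Q -> evalXY Q (a, 0) = 0 -> ((size (dehomogenize Q)).-1 < d)%N.
  move=> hQ; rewrite (evalXY_x0 _ hQ) => /eqP.
  rewrite mulf_eq0 expf_eq0 (negbTE a0) andbF/= => /eqP cd.
  have := size_dehomogenize hQ; rewrite leq_eqVlt => /orP[/eqP sz|].
    have : lead_coef (dehomogenize Q) = 0 by rewrite lead_coefE sz.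
    by move/eqP; rewrite lead_coef_eq0 => /eqP e; move: sz; rewrite e size_poly0.
  by case: (size _) => //; rewrite ltnS.
by move: (E _ h1 z1) (E _ h2 z2); rewrite -szd; lia.
Qed.

(** Row vectors carry the topology used for compactness, while measures live on tuples. *)
Definition of_row (v : 'rV[R]_4) : C2 R :=
  ((v ord0 i4_0 +i* v ord0 i4_1)%C, (v ord0 i4_2 +i* v ord0 i4_3)%C).

Lemma continuous_evalXY Q :
  continuous (fun v : 'rV[R]_4 => Re (evalXY Q (of_row v))) /\
  continuous (fun v : 'rV[R]_4 => Im (evalXY Q (of_row v))).
Proof.
apply: (@evalXY_closed _ _ of_row (fun f => continuous (f : 'rV[R]_4 -> R))).
- by move=> r; exact: cst_continuous.
- by move=> f g cf cg v; apply: continuousD; [exact: cf|exact: cg].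
- by move=> f g cf cg v; apply: continuousM; [exact: cf|exact: cg].
- exact: coord_continuous.
- exact: coord_continuous.
- exact: coord_continuous.
- exact: coord_continuous.
Qed.

Lemma continuous_sqr_norm2_lift F :
  continuous (fun v : 'rV[R]_4 => norm2 (eval_lift F (of_row v)) ^+ 2).
Proof.
under eq_fun do rewrite sqr_norm2 !sqr_modulus /=.
have [r1 i1] := continuous_evalXY F.1; have [r2 i2] := continuous_evalXY F.2.
have cX (f : 'rV[R]_4 -> R) : continuous f -> continuous (fun v => f v ^+ 2).
  by move=> cf v; apply: continuousM; exact: cf.
have cD (f g : 'rV[R]_4 -> R) : continuous f -> continuous g ->
    continuous (fun v => f v + g v).
  by move=> cf cg v; apply: continuousD; [exact: cf|exact: cg].
exact: cD (cD _ _ (cX _ r1) (cX _ i1)) (cD _ _ (cX _ r2) (cX _ i2)).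
Qed.

(** The square of the norm of F attains its minimum on the compact sphere, and the minimum is not 0
    since the origin is not on the sphere. *)
Lemma lift_bounded_below F :
  (forall z, norm2 (eval_lift F z) = 0 -> z = (0, 0)) ->
  exists2 c : R, 0 < c & forall z, norm2 z = 1 -> c <= norm2 (eval_lift F z).
Proof.
move=> F0; pose A := [set v : 'rV[R]_4 | norm2 (of_row v) ^+ 2 = 1].
have of_rowK z : exists v, of_row v = z.
  case: z => -[a b] [c d].
  exists (\row_j nth 0 [:: a; b; c; d] j).
  by rewrite /of_row !mxE.
have normA z v : of_row v = z -> norm2 z = 1 -> A v.
  by move=> vz z1; rewrite /A /= vz z1 expr1n.
have A0 : A !=set0.
  have [v vE] := of_rowK (1, 0); exists v; apply: (normA _ _ vE).
  by rewrite /norm2 /= modulus1 modulus0 expr1n expr0n addr0 sqrtr1.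
have cA : compact A.
  apply: (@subclosed_compact _ _
    [set v : 'rV[R]_4 | forall j, `[-1, 1]%classic (v ord0 j)]).
  (* The norm is that of the identity lift (X, Y), so the continuity already proved for lifts shows
     that A is closed. *)
  - have -> : A = (fun v : 'rV[R]_4 => norm2 (eval_lift
        (mpolyX R[i] (mnm1 ord0), mpolyX R[i] (mnm1 X2)) (of_row v)) ^+ 2)
        @^-1` [set x | x = 1].
      by apply/seteqP; split => v; rewrite /A /eval_lift /= evalXY_X evalXY_Y.
    apply: closed_comp; last exact: closed_eq.
    by move=> v _; exact: continuous_sqr_norm2_lift.
  - apply: (@rV_compact R 4 (fun=> `[-1, 1]%classic)) => j; exact: segment_compact.
  - move=> v; rewrite /A /= sqr_norm2 !sqr_modulus /= => e j.
    rewrite in_itv /= -ler_norml -(@ler_pXn2r _ 2)// ?nnegrE// expr1n.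
    rewrite real_normK ?num_real//.
    have s k := sqr_ge0 (v ord0 k).
    have := s i4_0; have := s i4_1; have := s i4_2; have := s i4_3.
    by case: j => -[|[|[|[|//]]]] h; rewrite (bool_irrelevance h (erefl true));
      move: e; lra.
have [w Aw wmin] := EVT_min_rV A0 cA
  (continuous_subspaceT (@continuous_sqr_norm2_lift F)).
rewrite inE /A /= in Aw.
exists (norm2 (eval_lift F (of_row w))).
  rewrite lt_neqAle norm2_ge0 andbT eq_sym; apply/eqP => /F0 w0.
  move: Aw; rewrite w0 /norm2 /= modulus0 expr0n/= addr0 sqrtr0 expr0n/=.
  by move/eqP; rewrite eq_sym oner_eq0.
move=> z z1; have [v vz] := of_rowK z.
rewrite -(@ler_pXn2r _ 2)// ?nnegrE ?norm2_ge0//.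
by rewrite -vz; apply: wmin; rewrite inE; exact: normA vz z1.
Qed.

End Lifts.

Theorem theorem3p4p1 (R : realType) (sigma : probability (4.-tuple R) R)
    (f : {fraction {poly R[i]}}) (d : nat) (F : polyXY R * polyXY R) :
  rotation_invariant_on_S3 sigma ->
  (1 <= d)%N ->
  has_degree f d ->
  homogeneous_lift f d F ->
  log_norm_integral sigma F =
    (d%:R * ln (pcap sigma S3 / pcap sigma (eval_lift F @^-1` S3)))%:E.
Proof.
move=> sigma_inv d1 fd hF; have [F1hom F2hom _ _] := hF.
have [c c0 Fc] := lift_bounded_below (fun z => lift_zero_free d1 fd hF).
have [B FB] := lift_bounded_above F.
have FcB (x : 4.-tuple R) : sphere x -> c <= norm2 (eval_lift F (toC2 x)) <= B.
  by move=> Dx; rewrite FB ?Fc// sphere_norm.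
have [M [N [_ _ _ liF]]] :=
  log_integral_bounded sigma_inv (measurable_norm2_lift F) c0 FcB.
(* The identity lift, of degree 1 and with logarithmic integral 0: [pcapE] then covers [S3] itself
   and gives expR (- J). *)
pose X : polyXY R * polyXY R := (mpolyX R[i] (mnm1 ord0), mpolyX R[i] (mnm1 X2)).
have XE z : eval_lift X z = z by case: z => a b; rewrite /eval_lift evalXY_X evalXY_Y.
have liX : log_integral sigma (fun x => norm2 (eval_lift X (toC2 x))) 0.
  rewrite -ln1; apply: eq_log_integral (log_integral_cst sigma_inv ltr01) => x Dx.
  by rewrite XE sphere_norm.
have X1hom i : homogeneous 1 (mpolyX R[i] (mnm1 (i : 'I_2))).
  by rewrite /homogeneous dhomogX /= mdeg1.
have Xc z : norm2 z = 1 -> 1 <= norm2 (eval_lift X z) by rewrite XE => ->.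
have S3E : S3 = eval_lift X @^-1` S3 :> set (C2 R).
  by apply/seteqP; split => z; rewrite /preimage/= XE.
have pS3 := pcapE (F := X) sigma_inv (ltn0Sn 0) (X1hom ord0) (X1hom X2) ltr01 Xc liX.
rewrite -S3E in pS3; rewrite pS3.
rewrite (pcapE sigma_inv d1 F1hom F2hom c0 Fc liF).
(* J cancels in the quotient, leaving d (s / d) with s = ln M - N. *)
rewrite -expRN -expRD expRK mul0r subr0.
rewrite (_ : _ * _ = ln M - N); first exact: liF.2.
by field; rewrite pnatr_eq0 -lt0n.
Qed.
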